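(* Let $1\le p<\infty$ and let $d_{w,p}$ be a Lorentz sequence space. If $T\in J^j$ and $T$ is not compact, then $J^j\subseteq J_T$.
   Context: Let $1\le p<\infty$ and let $w=(w_n)$ be a real sequence with $w_1=1$, $w_n\downarrow 0$ and $\sum_n w_n=\infty$. The Lorentz sequence space $d_{w,p}$ is the Banach space of all $x=(x_n)\in c_0$ with $\|x\|_{d_{w,p}}=\big(\sum_{n}w_n (x^*_n)^p\big)^{1/p}<\infty$, where $(x^*_n)$ is the non-increasing rearrangement of $(|x_n|)$. Let $(e_n)$, $(f_n)$ be the unit vector bases of $d_{w,p}$, $\ell_p$, and $j\colon\ell_p\to d_{w,p}$ the formal identity, $j(f_n)=e_n$. $J^j$ is the set of $S\in L(d_{w,p})$ of the form $S=AjB$ with $A\in L(d_{w,p})$, $B\in L(d_{w,p},\ell_p)$. $J_T=\{\sum_{i=1}^n A_iTB_i: n\in\mathbb N, A_i,B_i\in L(d_{w,p})\}$ is the ideal generated by $T$. *)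

(* Defs.v *)
From HB Require Import structures.
From mathcomp Require Import all_boot all_order all_algebra.
From mathcomp Require Import all_classical all_reals all_analysis.
Set Implicit Arguments. Unset Strict Implicit. Unset Printing Implicit Defensive.
Import Order.TTheory GRing.Theory Num.Theory.
Import numFieldNormedType.Exports.
Local Open Scope classical_set_scope.
Local Open Scope ring_scope.

Section Lorentz.
Variables (R : realType) (w : nat -> R) (p : R).

Definition seqR := nat -> R.

(* Non-increasing rearrangement (0-indexed): x^*_n is the infimum, over sets F
   of at most n indices, of sup_{k notin F} |x_k|  (the (n+1)-th largest |x_k|). *)
Definition xstar (x : seqR) (n : nat) : R :=
  fine (ereal_inf [set ereal_sup [set (`|x k|)%:E | k in [set k | k \notin F]]
                  | F in [set F : seq nat | (size F <= n)%N]]).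

Definition dsum (x : seqR) : \bar R :=
  (\sum_(0 <= n <oo) ((w n * (xstar x n) `^ p)%:E))%E.

Definition dwp : set seqR :=
  [set x | (x @ \oo --> (0 : R)) /\ (dsum x < +oo)%E].

Definition dnorm (x : seqR) : R := (fine (dsum x)) `^ p^-1.

Definition lpsum (x : seqR) : \bar R :=
  (\sum_(0 <= n <oo) ((`|x n| `^ p)%:E))%E.

Definition lp : set seqR := [set x | (lpsum x < +oo)%E].

Definition lpnorm (x : seqR) : R := (fine (lpsum x)) `^ p^-1.

(* bounded linear operators between normed sequence spaces (X,nX) and (Y,nY);
   operators are identified when they agree on X *)
Definition bounded_op (X Y : set seqR) (nX nY : seqR -> R)
  (T : seqR -> seqR) : Prop :=
  [/\ (forall x, X x -> Y (T x)),
      (forall (a : R) x y, X x -> X y ->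
         T (fun k => a * x k + y k) = (fun k => a * T x k + T y k)) &
      exists C : R, forall x, X x -> nY (T x) <= C * nX x].

Definition Ld (T : seqR -> seqR) := bounded_op dwp dwp dnorm dnorm T.
Definition Ldl (T : seqR -> seqR) := bounded_op dwp lp dnorm lpnorm T.

(* formal identity j : l_p -> d_{w,p} *)
Definition jmap : seqR -> seqR := fun x => x.

Definition in_Jj (S : seqR -> seqR) : Prop :=
  exists A B, Ld A /\ Ldl B /\ forall x, dwp x -> S x = A (jmap (B x)).

Definition in_JT (T S : seqR -> seqR) : Prop :=
  exists (n : nat) (A B : nat -> seqR -> seqR),
    (forall i, Ld (A i)) /\ (forall i, Ld (B i)) /\
    forall x, dwp x -> forall k, S x k = \sum_(i < n) A i (T (B i x)) k.

Definition compact_op (T : seqR -> seqR) : Prop :=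
  forall u : nat -> seqR, (forall m, dwp (u m)) ->
    (exists M : R, forall m, dnorm (u m) <= M) ->
    exists (phi : nat -> nat) (y : seqR),
      [/\ (forall m, (phi m < phi m.+1)%N), dwp y &
          (fun m => dnorm (fun k => T (u (phi m)) k - y k)) @ \oo --> (0 : R)].

End Lorentz.

(* Main.v *)
(* All estimates are on p-th powers of norms, with the quasi-triangle inequality
   |a + b|^p <= 2^p (|a|^p + |b|^p).

   Write T = A j B. Since T is not compact, differences of terms of a bounded sequence give bounded
   vectors y for which y, B y and T y are as small as we like on any given initial block of
   coordinates, while the norm of T y stays above a fixed bound. The sup norm of T y can also be
   kept away from 0. Otherwise a sum Y of N such vectors, chosen successively, would satisfy
   |T Y|^p >= c N, whereas B Y has bounded entries and |B Y|_p^p <= C N, which forces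
   |j B Y|^p = o(N) because w_n -> 0.

   Choosing the vectors successively and correcting them, one gets almost disjoint y_n and
   functionals phi_n, each close to a multiple of a coordinate functional, with
   phi_m (T y_n) = 1 if m = n and 0 otherwise. Then U a = sum_n a_n y_n is bounded from l_p to
   d_{w,p}, V x = (phi_n x)_n is bounded on d_{w,p}, and V T U = j. So S = A' j B' = (A' V) T (U B'). *)
Require Import Defs.
From HB Require Import structures.
From mathcomp Require Import all_boot all_order all_algebra.
From mathcomp Require Import all_classical all_reals all_analysis.
From mathcomp Require Import ring lra.
Set Implicit Arguments. Unset Strict Implicit. Unset Printing Implicit Defensive.
Import Order.TTheory GRing.Theory Num.Theory.
Import numFieldNormedType.Exports.
Local Open Scope classical_set_scope.
Local Open Scope ring_scope.

(** Rearrangements enter only to show that [dsum] is the supremum of [wsum] over duplicate-free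
    lists. A list sum is linear in the powers |x_k|^p and depends on finitely many coordinates, so
    tails, limits and perturbations can be treated without them. The price of p-th powers is a
    factor 2^p at each use of the quasi-triangle inequality. Sums of many vectors therefore need one
    of two devices: either the new vector is nearly disjoint from the old sum, so that the old power
    keeps coefficient 1, or the n-th term carries 2^-(n+1), which cancels a factor (2^p)^(n+1). U is
    bounded because disjoint y_n satisfy |sum a_n y_n|^p <= sum |a_n|^p |y_n|^p; V is bounded
    because selecting distinct coordinates does not increase the norm. A coordinate functional can
    detect T y only at a peak of fixed height, which is why flat T y must be excluded. *)

Section Preliminaries.
Variable R : realType.

(** * Series, finite lists and limits along ultrafilters *)

Lemma nneseries_leP (u : nat -> R) (M : R) : (forall n, 0 <= u n) ->
  (\sum_(0 <= n <oo) (u n)%:E <= M%:E)%E <->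
  (forall N, \sum_(i < N) u i <= M).
Proof.
move=> u0; split=> [uM N|uM].
  rewrite -lee_fin (le_trans _ uM)// -sumEFin -(big_mkord xpredT (EFin \o u)).
  by apply: nneseries_lim_ge => i _ _; rewrite lee_fin.
apply: lime_le; first by apply: is_cvg_nneseries => n _ _; rewrite lee_fin.
by apply: nearW => N; rewrite big_mkord sumEFin lee_fin.
Qed.

Lemma leq_max_seq (s : seq nat) k : k \in s -> (k <= \max_(j <- s) j)%N.
Proof. by move=> ks; exact: (@leq_bigmax_seq _ s xpredT id k ks isT). Qed.

Lemma nat_notin (F : seq nat) : exists k, k \notin F.
Proof.
exists (\max_(k <- F) k).+1.
by apply/negP => /leq_max_seq; rewrite ltnn.
Qed.

(** Only finitely many entries exceed a given positive one, so the maximum outside F is attained;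
    this lets the rearrangement be built greedily. *)
Lemma cvg0_max_notin (x : nat -> R) (F : seq nat) : x @ \oo --> (0 : R) ->
  exists2 k, k \notin F & forall j, j \notin F -> `|x j| <= `|x k|.
Proof.
move=> x0; have [[k1 k1F xk1]|H] := pselect (exists2 k, k \notin F & 0 < `|x k|).
  move/cvgr0Pnorm_lt : x0 => /(_ _ xk1)[N _ HN].
  have k1N : (k1 < maxn N k1.+1)%N by rewrite leq_max ltnSn orbT.
  have [/= i iF Hi] := @Order.TotalTheory.arg_maxP _ _ _ (Ordinal k1N)
    (fun i : 'I_(maxn N k1.+1) => (i : nat) \notin F) (fun i => `|x i|) k1F.
  exists (i : nat) => // j jF; have [jN|Nj] := ltnP j (maxn N k1.+1).
    exact: (Hi (Ordinal jN)).
  apply: (@le_trans _ _ `|x k1|); last exact: (Hi (Ordinal k1N)).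
  by apply: ltW; apply: HN => /=; rewrite (leq_trans _ Nj)// leq_maxl.
have [k kF] := nat_notin F; exists k => // j jF.
rewrite [leLHS](_ : _ = 0)//; apply/eqP; rewrite eq_le normr_ge0 andbT leNgt.
by apply/negP => xj; apply: H; exists j.
Qed.

Lemma uniq_sum_le (u : nat -> R) (s : seq nat) : (forall n, 0 <= u n) -> uniq s ->
  \sum_(k <- s) u k <= \sum_(i < (\max_(k <- s) k).+1) u i.
Proof.
move=> u0 us; set N := (_).+1.
rewrite -(big_mkord xpredT u) /= /index_iota subn0.
rewrite (perm_big _ (_ : perm_eq (iota 0 N) (s ++ [seq k <- iota 0 N | k \notin s]))).
  by rewrite big_cat/= lerDl sumr_ge0.
apply: uniq_perm; rewrite ?iota_uniq//.
  rewrite cat_uniq us filter_uniq ?iota_uniq// andbT andTb.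
  by apply/hasPn => k; rewrite mem_filter => /andP[].
move=> k; rewrite mem_cat mem_filter mem_iota add0n /=.
case: (boolP (k \in s)) => //= ks.
by rewrite ltnS leq_max_seq.
Qed.

Lemma near_all_lt (F : set_system nat) {FF : Filter F} (P : nat -> set nat) L :
  (forall k, F (P k)) -> F [set n | forall k, (k < L)%N -> P k n].
Proof.
move=> FP; elim: L => [|L IH]; first exact: filterE.
apply: filterS2 IH (FP L) => n HL PL k; rewrite ltnS leq_eqVlt.
by move=> /predU1P[->//|]; exact: HL.
Qed.

(** Compactness of [-c, c] gives a cluster point, and along an ultrafilter a cluster point is a
    limit. One ultrafilter serves all coordinates at once, in place of a diagonal subsequence. *)
Lemma ultra_bounded_cvg (F : set_system nat) (f : nat -> R) (c : R) :
  UltraFilter F -> (forall n, `|f n| <= c) -> exists l : R, f @ F --> l.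
Proof.
move=> FU fc; have FF : ProperFilter F := @ultra_proper _ _ FU.
have [|l [_ fl]] := @segment_compact R (- c) c (f @ F) _.
  by apply: (@filterE _ F) => n /=; rewrite in_itv /= -ler_norml.
exists l => V Vl; have [//|FV] := in_ultra_setVsetC (f @^-1` V) FU.
by have [y [yV /yV]] := fl (~` V) V FV Vl.
Qed.

Lemma dependent_choice_nat (X : Type) (I : X -> Prop) (Q : nat -> X -> X -> Prop) (a0 : X) :
  I a0 -> (forall n (a : X), I a -> exists b : X, I b /\ Q n a b) ->
  exists f : nat -> X, [/\ f 0 = a0, forall n, I (f n) & forall n, Q n (f n) (f n.+1)].
Proof.
move=> Ia0 H.
have H' (q : nat * {a : X | I a}) : exists b : {a : X | I a}, Q q.1 (sval q.2) (sval b).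
  by case: q => n [a Ia]; have [b [Ib Qb]] := H n a Ia; exists (exist _ b Ib).
have [g Hg] := choice H'.
pose f := fix f n : {a : X | I a} := if n is m.+1 then g (m, f m) else exist _ a0 Ia0.
exists (fun n => sval (f n)); split=> // n; first exact: (svalP (f n)).
exact: (Hg (n, f n)).
Qed.

End Preliminaries.

(** * Weighted sums along a list of indices *)

Section WeightedSums.
Variables (R : realType) (p : R).
Hypothesis p1 : 1 <= p.
Implicit Types (v x y z : nat -> R) (s : seq nat) (o : nat).

Let p0 : 0 < p. Proof. exact: lt_le_trans ltr01 p1. Qed.

Lemma powR0p : (0 : R) `^ p = 0. Proof. by rewrite powR0 ?gt_eqF. Qed.

Lemma ler_powRp (a b : R) : 0 <= a -> a <= b -> a `^ p <= b `^ p.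
Proof.
by move=> a0 ab; rewrite ge0_ler_powR ?nnegrE ?(ltW p0)// (le_trans a0).
Qed.

Lemma ler_powRp_inv (a b : R) : 0 <= b -> a `^ p <= b `^ p -> a <= b.
Proof.
move=> b0; apply: contra_le => ba.
by rewrite gt0_ltr_powR ?nnegrE// (le_trans b0 (ltW ba)).
Qed.

Lemma powRp_le1 (a : R) : 0 <= a <= 1 -> a `^ p <= a.
Proof.
move=> /andP[]; rewrite le_eqVlt => /orP[/eqP<- _|a0 a1]; first by rewrite powR0p.
by apply: ge1r_powR => //; rewrite a0.
Qed.

Lemma le_of_powRp_le (a c : R) : 1 <= c -> a `^ p <= c -> a <= c.
Proof.
move=> c1 ac; apply: ler_powRp_inv; first by rewrite (le_trans _ c1).
exact: le_trans ac (le1r_powR c1 p1).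
Qed.

Lemma powR2_ge1 : (1 : R) <= 2 `^ p.
Proof. by have := @ler_powRp 1 2 ler01 (ler1n R 2); rewrite powR1. Qed.

Lemma powRD_le (a b : R) :
  `|a + b| `^ p <= 2 `^ p * (`|a| `^ p + `|b| `^ p).
Proof.
wlog ab : a b / `|b| <= `|a|.
  move=> H; have [/H//|/ltW/H] := leP `|b| `|a|.
  by rewrite addrC [X in _ * X]addrC.
rewrite mulrDr -powRM// ler_wpDr ?mulr_ge0 ?powR_ge0//.
rewrite ler_powRp// (le_trans (ler_normD _ _))//; lra.
Qed.

Lemma powR_cvg T (F : set_system T) {FF : Filter F} (f : T -> R) (a : R) :
  f @ F --> a -> (fun t => `|f t| `^ p) @ F --> `|a| `^ p.
Proof.
(* Away from 0 the power is differentiable; at 0 the bound |f|^p <= |f| for |f| <= 1 is used. *)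
move=> fa; have [a0|a0] := eqVneq a 0.
  rewrite a0 in fa *; rewrite normr0 powR0p; apply/cvgrPdist_le => e e0.
  have d0 : 0 < Num.min 1 e by rewrite lt_min ltr01.
  near=> t.
  have : `|0 - f t| <= Num.min 1 e.
    by near: t; move: d0; move: (Num.min 1 e); exact/cvgrPdist_le.
  rewrite !sub0r !normrN le_min => /andP[f1 fe].
  by rewrite ger0_norm ?powR_ge0// (le_trans _ fe)// powRp_le1// normr_ge0.
have : (fun t => `|f t|) @ F --> `|a| by exact: cvg_norm.
have na : `|a| \in `]0, +oo[ by rewrite in_itv/= normr_gt0 a0.
have : {for `|a|, continuous (fun b : R => b `^ p)}.
  apply: differentiable_continuous; apply/derivable1_diffP.
  exact: derivable_powR.
by move=> c fa'; exact: cvg_comp fa' c.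
Unshelve. all: by end_near. Qed.

(* For [x] in c_0, [dsum w p x] is the supremum of [wsum w 0 s x] over the duplicate-free [s]
   ([dwp_wsum] and [wsum_dwp] below); the offset [o] shifts the weights. *)
Fixpoint wsum v o s x : R :=
  if s is k :: s' then v o * `|x k| `^ p + wsum v o.+1 s' x else 0.

Definition cut (P : pred nat) x : nat -> R := fun k => if P k then x k else 0.

Lemma wsum_cat v o s1 s2 x :
  wsum v o (s1 ++ s2) x = wsum v o s1 x + wsum v (o + size s1) s2 x.
Proof.
elim: s1 o => [|k s1 IH] o /=; first by rewrite add0r addn0.
by rewrite IH addrA addSnnS.
Qed.

Lemma wsum_comb v o s N (c : nat -> R) (y : nat -> nat -> R) x :
  (forall n, 0 <= v n) ->
  (forall k, k \in s -> `|x k| `^ p <= \sum_(n < N) c n * `|y n k| `^ p) ->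
  wsum v o s x <= \sum_(n < N) c n * wsum v o s (y n).
Proof.
move=> v0; elim: s o => [|k s IH] o H /=.
  by rewrite big1// => i _; rewrite mulr0.
under eq_bigr do rewrite mulrDr.
rewrite big_split/= lerD//; last by apply: IH => j js; rewrite H// inE js orbT.
under eq_bigr do rewrite mulrCA.
by rewrite -mulr_sumr ler_wpM2l// H// inE eqxx.
Qed.

Lemma wsum_comb2 v o s (a b : R) x y z : (forall n, 0 <= v n) ->
  (forall k, k \in s -> `|x k| `^ p <= a * `|y k| `^ p + b * `|z k| `^ p) ->
  wsum v o s x <= a * wsum v o s y + b * wsum v o s z.
Proof.
move=> v0 H.
have := @wsum_comb v o s 2 (fun n => if n is 0 then a else b)
  (fun n => if n is 0 then y else z) x v0.
by rewrite !big_ord_recl big_ord0/= addr0; apply => k /H;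
  rewrite !big_ord_recl big_ord0/= addr0.
Qed.

Lemma wsum_comb1 v o s (a : R) x y : (forall n, 0 <= v n) ->
  (forall k, k \in s -> `|x k| `^ p <= a * `|y k| `^ p) ->
  wsum v o s x <= a * wsum v o s y.
Proof.
move=> v0 H; rewrite -[leRHS]addr0 -[0 in leRHS](mul0r (wsum v o s y)).
by apply: wsum_comb2 => // k /H; rewrite mul0r addr0.
Qed.

Lemma wsumD v o s x y : (forall n, 0 <= v n) ->
  wsum v o s (fun k => x k + y k) <=
  2 `^ p * (wsum v o s x + wsum v o s y).
Proof.
by move=> v0; rewrite mulrDr; apply: wsum_comb2 => // k _; rewrite -mulrDr powRD_le.
Qed.

Lemma wsum_eq v o s x y : (forall k, k \in s -> `|x k| = `|y k|) ->
  wsum v o s x = wsum v o s y.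
Proof.
elim: s o => //= k s IH o H; rewrite H ?inE ?eqxx// IH// => j js.
by rewrite H// inE js orbT.
Qed.

Lemma wsum_scale v o s (a : R) x :
  wsum v o s (fun k => a * x k) = `|a| `^ p * wsum v o s x.
Proof.
elim: s o => [|k s IH] o /=; first by rewrite mulr0.
by rewrite IH mulrDr normrM powRM// mulrCA.
Qed.

Lemma wsum_split v o s (P : pred nat) x :
  wsum v o s x = wsum v o s (cut P x) + wsum v o s (cut (predC P) x).
Proof.
elim: s o => [|k s IH] o /=; first by rewrite addr0.
rewrite IH addrACA /cut/=; case: (P k); rewrite /= normr0 powR0p mulr0.
  by rewrite addr0.
by rewrite add0r.
Qed.

Lemma wsum_cvg T (F : set_system T) {FF : Filter F} v o s (f : T -> nat -> R) x :
  (forall k, k \in s -> (fun t => f t k) @ F --> x k) ->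
  (fun t => wsum v o s (f t)) @ F --> wsum v o s x.
Proof.
elim: s o => [|k s IH] o H /=; first exact: cvg_cst.
apply: cvgD; last by apply: IH => j js; apply: H; rewrite inE js orbT.
by apply: cvgMr; apply: powR_cvg; apply: H; rewrite inE eqxx.
Qed.

Lemma wsum_near v o s x e : 0 < e -> exists2 eta, 0 < eta &
  forall h, (forall k, k \in s -> `|h k| <= eta) ->
    `|wsum v o s (fun k => x k + h k) - wsum v o s x| <= e.
Proof.
elim: s o e => [|k s IH] o e e0 /=.
  by exists 1 => // h _; rewrite subrr normr0 ltW.
have e2 : 0 < e / 2 by rewrite divr_gt0.
have [eta1 eta10 H1] := IH o.+1 _ e2.
have : (fun t : R => v o * `|x k + t| `^ p) @ (0 : R) --> v o * `|x k| `^ p.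
  apply: cvgMr; apply: powR_cvg; rewrite -[x in _ --> x]addr0.
  by apply: cvgD; [exact: cvg_cst|exact: cvg_id].
move/cvgrPdist_le => /(_ _ e2) /nbhs_ballP[d /= d0 Hd].
exists (Num.min eta1 (d / 2)); first by rewrite lt_min eta10 divr_gt0.
move=> h Hh.
have hk : `|h k| < d.
  have := Hh k; rewrite inE eqxx le_min => /(_ isT) /andP[_ /le_lt_trans]; apply.
  by rewrite ltr_pdivrMr// ltr_pMr// ltr1n.
have /H1 B : forall j, j \in s -> `|h j| <= eta1.
  by move=> j js; have := Hh j; rewrite inE js orbT le_min => /(_ isT) /andP[].
have /Hd/= A : ball 0 d (h k) by rewrite /ball/= sub0r normrN.
rewrite opprD addrACA (le_trans (ler_normD _ _))//.
by rewrite [leRHS]splitr lerD// distrC.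
Qed.

Lemma wsum1 o s x : wsum (fun=> 1) o s x = \sum_(k <- s) `|x k| `^ p.
Proof.
elim: s o => [|k s IH] o /=; first by rewrite big_nil.
by rewrite big_cons IH mul1r.
Qed.

Section DecreasingWeight.
Variable v : nat -> R.
Hypotheses (v0 : forall n, 0 <= v n) (vle1 : forall n, v n <= 1)
  (vS : forall n, v n.+1 <= v n).

Lemma wsum_offsetS o s x : wsum v o.+1 s x <= wsum v o s x.
Proof. by elim: s o => //= k s IH o; rewrite lerD// ler_wpM2r ?powR_ge0. Qed.

(** Cut entries contribute nothing but still occupy weights; deleting them moves the remaining ones
    to earlier, larger weights. *)
Lemma wsum_filter o s (P : pred nat) x :
  wsum v o s (cut P x) <= wsum v o [seq k <- s | P k] x.
Proof.
elim: s o => //= k s IH o; rewrite {1}/cut; case: ifP => _ /=.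
  by rewrite lerD2l.
by rewrite normr0 powR0p mulr0 add0r (le_trans _ (IH o))// wsum_offsetS.
Qed.

(** A shift by one place loses at most the telescoping sum of (v i - v i.+1) * S, hence at most S.
    For a flat vector S is small and a bounded shift is negligible. *)
Lemma wsum_shift o s l x S : 0 <= S ->
  (forall k, k \in s -> `|x k| `^ p <= S) ->
  wsum v o s x <= wsum v (o + l) s x + l%:R * S.
Proof.
move=> S0 xS; elim: l => [|l IH]; first by rewrite addn0 mul0r addr0.
apply: (le_trans IH); rewrite -natr1 mulrDl mul1r addrA addrAC lerD2r addnS.
suff H u : wsum v u s x <= wsum v u.+1 s x + (v u - v (u + size s)%N) * S.
  apply: (le_trans (H _)); rewrite lerD2l ler_piMl//.
  by rewrite lerBlDr (le_trans (vle1 _))// lerDl.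
elim: s u xS {IH} => [|k s IH] u xS /=.
  by rewrite addn0 subrr mul0r addr0.
have xk : `|x k| `^ p <= S by apply: xS; rewrite inE eqxx.
have H1 : (v u - v u.+1) * (`|x k| `^ p) <= (v u - v u.+1) * S.
  by rewrite ler_wpM2l// subr_ge0.
have : wsum v u.+1 s x <= wsum v u.+2 s x + (v u.+1 - v (u.+1 + size s)%N) * S.
  by apply: IH => j js; apply: xS; rewrite inE js orbT.
rewrite addSnnS; nra.
Qed.

Lemma wsum_le_wsum1 o s x : wsum v o s x <= \sum_(k <- s) `|x k| `^ p.
Proof.
elim: s o => [|k s IH] o /=; first by rewrite big_nil.
by rewrite big_cons lerD// ler_piMl ?powR_ge0.
Qed.

(** The first N positions are bounded through the sup norm, the later ones through the weight v N
    and the l_p sum. With S and B / N bounded and weights tending to 0, this gives o(N). *)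
Lemma wsum_split_le s N x S B : 0 <= S ->
  (forall k, `|x k| `^ p <= S) -> \sum_(k <- s) `|x k| `^ p <= B ->
  wsum v 0 s x <= S * \sum_(i < N) v i + v N * B.
Proof.
move=> S0 xS sB.
have v_le n m : (n <= m)%N -> v m <= v n.
  by move=> /subnK <-; elim: (m - n)%N => // d; apply: le_trans; rewrite addSn.
have H1 o t : (size t <= N)%N -> wsum v o t x <= S * \sum_(i < N) v (o + i)%N.
  elim: N t o {sB} => [|N IH] [|k t] o //= tN.
  - by rewrite big_ord0 mulr0.
  - by rewrite mulr_ge0// sumr_ge0.
  - rewrite big_ord_recl addn0 mulrDr lerD//; first by rewrite mulrC ler_wpM2r.
    apply: le_trans (IH t o.+1 tN) _; rewrite ler_wpM2l// ler_sum// => i _.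
    by rewrite addSnnS.
have H2 o t : (N <= o)%N -> wsum v o t x <= v N * \sum_(k <- t) `|x k| `^ p.
  elim: t o => [|k t IH] o No /=; first by rewrite big_nil mulr0.
  rewrite big_cons mulrDr lerD ?ler_wpM2r ?powR_ge0 ?v_le//.
  exact/IH/(leq_trans No).
have := cat_take_drop N s => E.
rewrite -{1}E wsum_cat; apply: lerD.
  apply: le_trans (H1 _ _ _) _; first by rewrite size_take_min geq_minl.
  by rewrite ler_wpM2l// ler_sum.
have [sN|sN] := leqP (size s) N.
  rewrite drop_oversize//= mulr_ge0// (le_trans _ sB)//.
  by apply: sumr_ge0 => i _; exact: powR_ge0.
apply: le_trans (H2 _ _ _) _; first by rewrite add0n size_takel// ltnW.
rewrite ler_wpM2l//; apply: le_trans sB; rewrite -[in leRHS]E big_cat/=.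
by rewrite lerDr; apply: sumr_ge0 => i _; exact: powR_ge0.
Qed.

End DecreasingWeight.

End WeightedSums.

(** * The Lorentz and l_p norms through finite sums *)

Record lorentz_weight (R : realType) (w : nat -> R) (p : R) : Prop := LorentzWeight {
  lw_exponent : 1 <= p;
  lw_first : w 0 = 1;
  lw_decr : forall n, w n.+1 <= w n;
  lw_cvg0 : w @ \oo --> (0 : R);
  lw_div : (\sum_(0 <= n <oo) (w n)%:E)%E = +oo%E
}.

HB.lock Definition dnormp (R : realType) (w : nat -> R) (p : R) (x : seqR R) : R :=
  fine (dsum w p x).

HB.lock Definition lnormp (R : realType) (p : R) (x : seqR R) : R := fine (lpsum p x).

Section LorentzSums.
Variables (R : realType) (w : nat -> R) (p : R).
Hypothesis lw : lorentz_weight w p.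
Let p1 : 1 <= p. Proof. exact: lw_exponent lw. Qed.
Let w0 : w 0 = 1. Proof. exact: lw_first lw. Qed.
Let wS n : w n.+1 <= w n. Proof. exact: lw_decr lw n. Qed.
Implicit Types (x y z : seqR R) (s : seq nat).

Local Notation ws := (wsum p w).
Local Notation dpow := (dnormp w p).
Local Notation lpow := (lnormp p).

Let p0 : 0 < p. Proof. exact: lt_le_trans ltr01 p1. Qed.

Lemma w_ge0 n : 0 <= w n.
Proof.
have wcv := lw_cvg0 lw; have <- : limn w = 0 by exact/cvg_lim.
apply: nonincreasing_cvgn_ge; last by apply/cvg_ex; exists 0.
exact/nonincreasing_seqP.
Qed.

Lemma w_le n m : (n <= m)%N -> w m <= w n.
Proof.
by move=> /subnK <-; elim: (m - n)%N => // d; apply: le_trans; rewrite addSn.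
Qed.

Lemma w_le1 n : w n <= 1.
Proof. by rewrite -w0 w_le. Qed.

(** Infinitely many entries above e would give lists of every length N made of them, so that e^p
    times the sum of the first N weights stays below M, against the divergence of the weights. *)
Lemma wsum_bounded_cvg0 x (M : R) :
  (forall s, uniq s -> ws 0 s x <= M) -> x @ \oo --> (0 : R).
Proof.
move=> xM; apply: contrapT => nx.
have [e e0 He] : exists2 e : R, 0 < e & forall N, exists2 n, (N <= n)%N & e < `|x n|.
  apply: contrapT => H; apply: nx; apply/cvgr0Pnorm_le => e e0.
  apply: contrapT => H2; apply: H; exists e => // N.
  apply: contrapT => H3; apply: H2; exists N => // n /= Nn.
  by rewrite leNgt; apply/negP => xn; apply: H3; exists n.
have H m : exists s, [/\ uniq s, size s = m & forall k, k \in s -> e <= `|x k|].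
  elim: m => [|m [s [us sm xs]]]; first by exists [::].
  have [n ns en] := He (\max_(k <- s) k).+1.
  exists (n :: s); split => /=; rewrite ?sm// ?us ?andbT.
    by apply/negP => /leq_max_seq; rewrite leqNgt ns.
  by move=> k; rewrite inE => /predU1P[->|/xs//]; exact: ltW.
have ep : 0 < e `^ p by rewrite powR_gt0.
suff : (\sum_(0 <= n <oo) (w n)%:E <= (M / e `^ p)%:E)%E by rewrite (lw_div lw).
apply/nneseries_leP => [n|N]; first exact: w_ge0.
have [s [us <- xs]] := H N; rewrite ler_pdivlMr// (le_trans _ (xM s us))//.
move: {us} s xs => s xs; have : forall o, (\sum_(i < size s) w (o + i)%N) * e `^ p <= ws o s x.
  elim: s xs => [|k t IH] xs o /=; first by rewrite big_ord0 mul0r.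
  rewrite big_ord_recl addn0 mulrDl lerD//.
    by rewrite ler_wpM2l ?w_ge0// ler_powRp// ?(ltW e0)// xs ?inE ?eqxx.
  apply: le_trans (IH _ o.+1); last by move=> j js; rewrite xs// inE js orbT.
  by rewrite ler_wpM2r ?powR_ge0// ler_sum// => i _; rewrite addSnnS.
by move=> /(_ 0).
Qed.

(** * The non-increasing rearrangement compared with finite lists *)

Lemma xstarE x n : x @ \oo --> (0 : R) -> (xstar x n)%:E =
  ereal_inf [set ereal_sup [set (`|x k|)%:E | k in [set k | k \notin F]]
                  | F in [set F : seq nat | (size F <= n)%N]].
Proof.
move=> x0; rewrite /xstar fineK// fin_real//; apply/andP; split.
  apply: (@lt_le_trans _ _ 0%E); first exact: ltNy0.
  apply: le_ereal_inf_tmp => _ [F _ <-]; have [k kF] := nat_notin F.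
  apply: (@le_trans _ _ (`|x k|)%:E); first by rewrite lee_fin.
  by apply: ereal_sup_ubound; exists k.
have [k _ Hk] := cvg0_max_notin [::] x0.
apply: (@le_lt_trans _ _ (`|x k|)%:E); last exact: ltry.
apply: le_trans (ereal_inf_lbound _) _; first by exists [::].
by apply: ge_ereal_sup => _ [j _ <-]; rewrite lee_fin Hk.
Qed.

Lemma xstar_ge0 x n : x @ \oo --> (0 : R) -> 0 <= xstar x n.
Proof.
move=> x0; rewrite -lee_fin xstarE//.
apply: le_ereal_inf_tmp => _ [F _ <-]; have [k kF] := nat_notin F.
apply: (@le_trans _ _ (`|x k|)%:E); first by rewrite lee_fin.
by apply: ereal_sup_ubound; exists k.
Qed.

(** Greedy choice: s is extended by the index of a largest remaining entry, and s itself competes in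
    the infimum defining [xstar]. *)
Lemma xstar_attained x n : x @ \oo --> (0 : R) ->
  exists s, [/\ uniq s, size s = n &
    forall i, (i < n)%N -> xstar x i <= `|x (nth 0 s i)|].
Proof.
move=> x0; elim: n => [|n [s [us sn xs]]]; first by exists [::].
have [k ks Hk] := cvg0_max_notin s x0.
exists (rcons s k); rewrite rcons_uniq ks us size_rcons sn; split=> // i.
rewrite ltnS leq_eqVlt nth_rcons sn => /predU1P[->|ni]; last by rewrite ni xs.
rewrite ltnn eqxx -lee_fin xstarE//.
apply: le_trans (ereal_inf_lbound _) _; first by exists s => //=; rewrite sn.
by apply: ge_ereal_sup => _ [j js <-]; rewrite lee_fin Hk.
Qed.

(** Pigeonhole: a list F shorter than s misses some index of s. *)
Lemma le_xstar x s (m : R) : x @ \oo --> (0 : R) -> uniq s ->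
  (forall k, k \in s -> m <= `|x k|) -> (0 < size s)%N ->
  m <= xstar x (size s).-1.
Proof.
move=> x0 us sm s0; rewrite -lee_fin xstarE//.
apply: le_ereal_inf_tmp => _ [F /= Fs <-].
have [k ks kF] : exists2 k, k \in s & k \notin F.
  apply/hasP; apply: contraT; rewrite has_predC negbK => /allP sF.
  have := uniq_leq_size us sF; rewrite leqNgt => /negP[].
  by rewrite (leq_ltn_trans Fs)// ltn_predL.
apply: (@le_trans _ _ (`|x k|)%:E); first by rewrite lee_fin sm.
by apply: ereal_sup_ubound; exists k.
Qed.

(** Moving a smallest entry to the end does not decrease the sum: every entry behind it moves up one
    weight, and these gains telescope to at least what the smallest entry loses. *)
Lemma wsum_rem o s k x : k \in s ->
  (forall j, j \in s -> `|x k| <= `|x j|) ->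
  ws o s x <= ws o (rem k s) x + w (o + (size s).-1) * `|x k| `^ p.
Proof.
have shift u t : (forall j, j \in t -> `|x k| <= `|x j|) ->
    ws u.+1 t x + (w u - w (u + size t)) * `|x k| `^ p <= ws u t x.
  elim: t u => [|j t IH] u H /=; first by rewrite addn0 subrr mul0r addr0.
  have xj : `|x k| `^ p <= `|x j| `^ p.
    by rewrite ler_powRp// H// inE eqxx.
  have B : forall i, i \in t -> i \in j :: t.
    by move=> i it; rewrite inE it orbT.
  have A : (w u - w u.+1) * (`|x k| `^ p) <= (w u - w u.+1) * `|x j| `^ p.
    by rewrite ler_wpM2l// subr_ge0.
  have := IH u.+1 (fun i it => H i (B i it)); rewrite addSnnS; nra.
elim: s o => // j s IH o; rewrite inE /=; case: (eqVneq j k) => [->|jk] /= ks H.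
  have B : forall i, i \in s -> i \in k :: s.
    by move=> i it; rewrite inE it orbT.
  have := shift o s (fun i it => H i (B i it)); nra.
have B : forall i, i \in s -> i \in j :: s.
  by move=> i it; rewrite inE it orbT.
rewrite -addrA lerD2l.
have := IH o.+1 ks (fun i it => H i (B i it)).
by case: s ks {IH H B} => // a s _ /=; rewrite addSnnS.
Qed.

(** Induction on the size: a smallest entry is moved to the last weight, where [le_xstar] bounds it,
    and the rest is a shorter list. *)
Lemma wsum_le_xstar x s : x @ \oo --> (0 : R) -> uniq s ->
  ws 0 s x <= \sum_(i < size s) w i * xstar x i `^ p.
Proof.
move=> x0; have [n] := ubnP (size s); elim: n s => // n IH s.
rewrite ltnS => sn us; case: (posnP (size s)) => [/size0nil ->|s0].
  by rewrite big_ord0.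
have i0s : (0 < size s)%N by [].
have [/= i _ Hi] := @Order.TotalTheory.arg_minP _ _ _ (Ordinal i0s)
    xpredT (fun i : 'I_(size s) => `|x (nth 0 s i)|) isT.
set k := nth 0 s i in Hi; have ks : k \in s by rewrite mem_nth.
have Hk j : j \in s -> `|x k| <= `|x j|.
  move=> js; have jS : (index j s < size s)%N by rewrite index_mem.
  by have := Hi (Ordinal jS) isT; rewrite /= nth_index.
apply: le_trans (wsum_rem 0 ks Hk) _.
have sz : size s = (size (rem k s)).+1 by rewrite size_rem// prednK.
have xk := le_xstar x0 us Hk s0; move: sn xk; rewrite sz => sn xk.
rewrite big_ord_recr /= lerD//; first by apply: IH; rewrite ?rem_uniq.
by rewrite add0n ler_wpM2l ?w_ge0// ler_powRp.
Qed.

Lemma dsum_ge0 x : (0 <= dsum w p x)%E.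
Proof. by apply: nneseries_ge0 => n _ _; rewrite lee_fin mulr_ge0 ?w_ge0 ?powR_ge0. Qed.

Lemma dpow_ge0 x : 0 <= dpow x. Proof. by rewrite dnormp.unlock; exact/fine_ge0/dsum_ge0. Qed.

Lemma dpowK x : dwp w p x -> (dpow x)%:E = dsum w p x.
Proof. by move=> [_ xf]; rewrite dnormp.unlock fineK// ge0_fin_numE// dsum_ge0. Qed.

Lemma dwp_wsum x s : dwp w p x -> uniq s -> ws 0 s x <= dpow x.
Proof.
move=> xd us; apply: le_trans (wsum_le_xstar xd.1 us) _.
have H n : 0 <= w n * xstar x n `^ p by rewrite mulr_ge0 ?w_ge0 ?powR_ge0.
by apply: (nneseries_leP (dpow x) H).1; rewrite dpowK.
Qed.

Lemma wsum_dwp x (M : R) : (forall s, uniq s -> ws 0 s x <= M) ->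
  dwp w p x /\ dpow x <= M.
Proof.
move=> xM; have x0 := wsum_bounded_cvg0 xM.
have H : (dsum w p x <= M%:E)%E.
  apply/nneseries_leP => [n|N]; first by rewrite mulr_ge0 ?w_ge0 ?powR_ge0.
  have [s [us sN xs]] := xstar_attained N x0.
  apply: le_trans (xM s us); rewrite -{N}sN in xs *.
  have : forall o, (forall i, (i < size s)%N -> xstar x (o + i) <= `|x (nth 0 s i)|) ->
      \sum_(i < size s) w (o + i)%N * xstar x (o + i) `^ p <= ws o s x.
    elim: s {us xs} => [|k s IH] o H /=; first by rewrite big_ord0.
    rewrite big_ord_recl addn0 lerD//.
      rewrite ler_wpM2l ?w_ge0// ler_powRp// ?xstar_ge0//.
      by have := H 0 isT; rewrite addn0.
    under eq_bigr => i _ do rewrite -addSnnS.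
    by apply: IH => i si; rewrite addSnnS; apply: H.
  by move=> /(_ 0 xs).
have xd : dwp w p x by split => //; apply: le_lt_trans H (ltry _).
by split => //; rewrite -lee_fin dpowK.
Qed.

Lemma wsum_ltdpow x (a : R) : dwp w p x -> a < dpow x ->
  exists2 s, uniq s & a < ws 0 s x.
Proof.
move=> xd; apply: contraPP => H; apply/negP; rewrite -leNgt.
apply: (wsum_dwp _).2 => s us; rewrite leNgt; apply/negP => as_.
by apply: H; exists s.
Qed.

Lemma dwp_cvg0 x : dwp w p x -> x @ \oo --> (0 : R).
Proof. by case. Qed.

Lemma dwp_norm_le x k : dwp w p x -> `|x k| `^ p <= dpow x.
Proof.
by move=> xd; have := @dwp_wsum x [:: k] xd isT; rewrite /= w0 mul1r addr0.
Qed.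

(** A Fatou property: each [wsum] depends on finitely many coordinates, so its bound survives
    coordinatewise limits. *)
Lemma dwp_lim (F : set_system nat) {FF : ProperFilter F} (u : nat -> seqR R) x (M : R) :
  (forall k, u n k @[n --> F] --> x k) ->
  (\forall n \near F, dwp w p (u n) /\ dpow (u n) <= M) ->
  dwp w p x /\ dpow x <= M.
Proof.
move=> ux uM; apply: wsum_dwp => s us.
have uxs : (fun n => ws 0 s (u n)) @ F --> ws 0 s x by apply: wsum_cvg.
apply: (cvgr_to_le uxs).
by apply: filterS uM => n [un nM]; apply: le_trans nM; exact: dwp_wsum.
Qed.

Lemma dwp_comb x y z (a b : R) : 0 <= a -> 0 <= b -> dwp w p y -> dwp w p z ->
  (forall k, `|x k| `^ p <= a * `|y k| `^ p + b * `|z k| `^ p) ->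
  dwp w p x /\ dpow x <= a * dpow y + b * dpow z.
Proof.
move=> a0 b0 yd zd H; apply: wsum_dwp => s us.
apply: le_trans (wsum_comb2 0 w_ge0 (fun k _ => H k)) _.
by rewrite lerD// ler_wpM2l// dwp_wsum.
Qed.

Lemma dwpD x y : dwp w p x -> dwp w p y ->
  dwp w p (fun k => x k + y k) /\
  dpow (fun k => x k + y k) <= 2 `^ p * (dpow x + dpow y).
Proof.
by move=> xd yd; rewrite mulrDr; apply: dwp_comb; rewrite ?powR_ge0// => k;
  rewrite -mulrDr powRD_le.
Qed.

Lemma dwpZ x (a : R) : dwp w p x ->
  dwp w p (fun k => a * x k) /\ dpow (fun k => a * x k) <= `|a| `^ p * dpow x.
Proof.
move=> xd; rewrite -[leRHS]addr0 -[0 in leRHS](mul0r (dpow x)).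
apply: dwp_comb; rewrite ?powR_ge0// => k.
by rewrite mul0r addr0 normrM powRM.
Qed.

Lemma dwpB x y : dwp w p x -> dwp w p y ->
  dwp w p (fun k => x k - y k) /\
  dpow (fun k => x k - y k) <= 2 `^ p * (dpow x + dpow y).
Proof.
move=> xd yd; rewrite mulrDr; apply: dwp_comb; rewrite ?powR_ge0// => k.
by rewrite -mulrDr (le_trans (powRD_le p1 _ _))// normrN.
Qed.

Lemma dwp0 : dwp w p (fun=> 0) /\ dpow (fun=> 0) = 0.
Proof.
have [] : dwp w p (fun=> 0) /\ dpow (fun=> 0) <= 0.
  apply: wsum_dwp => s _; elim: s 0%N => //= k s IH o.
  by rewrite normr0 powR0p// mulr0 add0r.
by move=> H1 H2; split => //; apply/eqP; rewrite eq_le H2 dpow_ge0.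
Qed.

Lemma lpow_ge0 x : 0 <= lpow x.
Proof.
by rewrite lnormp.unlock; apply: fine_ge0; apply: nneseries_ge0 => n _ _; rewrite lee_fin powR_ge0.
Qed.

Lemma lpowK x : lp p x -> (lpow x)%:E = lpsum p x.
Proof.
move=> xf; rewrite lnormp.unlock fineK// ge0_fin_numE// nneseries_ge0//.
Qed.

Lemma lp_sum x N : lp p x -> \sum_(i < N) `|x i| `^ p <= lpow x.
Proof.
move=> xl; have H n : 0 <= `|x n| `^ p by exact: powR_ge0.
by apply: (nneseries_leP (lpow x) H).1; rewrite lpowK.
Qed.

Lemma sum_lp x (M : R) : (forall N, \sum_(i < N) `|x i| `^ p <= M) ->
  lp p x /\ lpow x <= M.
Proof.
move=> xM; have H : (lpsum p x <= M%:E)%E.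
  by apply/nneseries_leP => // n; rewrite powR_ge0.
have xl : lp p x by apply: le_lt_trans H (ltry _).
by split => //; rewrite -lee_fin lpowK.
Qed.

Lemma lp_sum_uniq x s : lp p x -> uniq s -> \sum_(k <- s) `|x k| `^ p <= lpow x.
Proof.
move=> xl us; apply: le_trans (lp_sum _ xl).
by apply: uniq_sum_le => // n; rewrite powR_ge0.
Qed.

Lemma lp_dwp x : lp p x -> dwp w p x /\ dpow x <= lpow x.
Proof.
move=> xl; apply: wsum_dwp => s us; apply: le_trans (lp_sum_uniq xl us).
by apply: wsum_le_wsum1; exact: w_le1.
Qed.

(** * Bounded operators in terms of p-th powers *)

Lemma powR_root_le (a b C : R) : 0 <= a -> 0 <= b -> a `^ p^-1 <= C * b `^ p^-1 ->
  a <= `|C| `^ p * b.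
Proof.
move=> a0 b0 H.
have E c : 0 <= c -> (c `^ p^-1) `^ p = c.
  by move=> c0; rewrite -powRrM mulVf ?gt_eqF// powRr1.
rewrite -[leLHS]E// -[X in _ * X]E// -powRM ?powR_ge0//.
rewrite ler_powRp ?powR_ge0// (le_trans H)//.
by rewrite ler_wpM2r ?powR_ge0// ler_norm.
Qed.

Lemma root_powR_le (a b C : R) : 0 <= a -> 0 <= b -> 0 <= C -> a <= C * b ->
  a `^ p^-1 <= C `^ p^-1 * b `^ p^-1.
Proof.
move=> a0 b0 C0 H; rewrite -powRM//.
by rewrite ge0_ler_powR ?invr_ge0 ?(ltW p0)// nnegrE ?mulr_ge0.
Qed.

Lemma dnormE x : dnorm w p x = dpow x `^ p^-1.
Proof. by rewrite dnormp.unlock. Qed.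

Lemma lpnormE x : lpnorm p x = lpow x `^ p^-1.
Proof. by rewrite lnormp.unlock. Qed.

Lemma LdP (T : seqR R -> seqR R) : Ld w p T <->
  [/\ (forall x, dwp w p x -> dwp w p (T x)),
      (forall (a : R) x y, dwp w p x -> dwp w p y ->
         T (fun k => a * x k + y k) = (fun k => a * T x k + T y k)) &
      exists2 C : R, 0 <= C & forall x, dwp w p x -> dpow (T x) <= C * dpow x].
Proof.
split=> -[T1 T2].
  move=> [C HC]; split => //; exists (`|C| `^ p); first exact: powR_ge0.
  by move=> x xd; apply: powR_root_le; rewrite ?dpow_ge0// -!dnormE; exact: HC.
move=> [C C0 HC]; split => //; exists (C `^ p^-1) => x xd.
by rewrite !dnormE; apply: root_powR_le; rewrite ?dpow_ge0// HC.
Qed.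

Lemma LdlP (T : seqR R -> seqR R) : Ldl w p T ->
  [/\ (forall x, dwp w p x -> lp p (T x)),
      (forall (a : R) x y, dwp w p x -> dwp w p y ->
         T (fun k => a * x k + y k) = (fun k => a * T x k + T y k)) &
      exists2 C : R, 0 <= C & forall x, dwp w p x -> lpow (T x) <= C * dpow x].
Proof.
move=> [T1 T2 [C HC]]; split => //; exists (`|C| `^ p); first exact: powR_ge0.
by move=> x xd; apply: powR_root_le; rewrite ?dpow_ge0 ?lpow_ge0// -dnormE -lpnormE; exact: HC.
Qed.

(** * Flat vectors *)

Lemma cut_lt_lp x L (eta : R) : 0 <= eta -> (forall k, (k < L)%N -> `|x k| <= eta) ->
  lp p (cut (fun k => k < L)%N x) /\
  lpow (cut (fun k => k < L)%N x) <= L%:R * eta `^ p.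
Proof.
move=> eta0 xL; apply: sum_lp => N.
apply: (@le_trans _ _ ((minn N L)%:R * eta `^ p)); last first.
  by rewrite ler_wpM2r ?powR_ge0// ler_nat geq_minr.
elim: N => [|N IH]; first by rewrite big_ord0 min0n mul0r.
rewrite big_ord_recr /= {2}/cut; case: ltnP => NL.
  rewrite (minn_idPl NL) -natr1 mulrDl mul1r lerD//.
    by apply: le_trans IH _; rewrite (minn_idPl (ltnW NL)).
  by rewrite ler_powRp// xL.
rewrite normr0 powR0p// addr0 (le_trans IH)// ler_wpM2r ?powR_ge0// ler_nat.
by rewrite leq_min geq_minr (leq_trans (geq_minl _ _)).
Qed.

Lemma wsum_cut_lt s x L (eta : R) : uniq s -> 0 <= eta ->
  (forall k, (k < L)%N -> `|x k| <= eta) ->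
  ws 0 s (cut (fun k => k < L)%N x) <= L%:R * eta `^ p.
Proof.
move=> us eta0 xL; have [xl xle] := cut_lt_lp eta0 xL.
have [xd xdl] := lp_dwp xl.
exact: le_trans (dwp_wsum xd us) (le_trans xdl xle).
Qed.

Lemma small_powR (m : nat) (e : R) : 0 < e -> exists2 eta : R, 0 < eta <= 1 & m%:R * eta `^ p <= e.
Proof.
move=> e0; have m0 : (0 : R) < m.+1%:R by rewrite ltr0n.
exists (Num.min 1 (e / m.+1%:R)); first by rewrite lt_min ltr01 divr_gt0//= ge_min lexx.
set eta := Num.min _ _.
have eta0 : 0 <= eta by rewrite le_min ler01 divr_ge0// ltW.
have eta1 : eta <= 1 by rewrite ge_min lexx.
have etae : eta <= e / m.+1%:R by rewrite ge_min lexx orbT.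
apply: (@le_trans _ _ (m.+1%:R * eta)); last by rewrite mulrC -ler_pdivlMr.
by apply: ler_pM; rewrite ?powR_ge0 ?ler_nat// powRp_le1 ?eta0.
Qed.

(** Appending s' to s gives a duplicate-free list, whose sum is at most [dpow t]; hence what follows
    s can carry at most e. *)
Lemma wsum_near_optimal t (e : R) : dwp w p t -> 0 < e -> exists s,
  [/\ uniq s, dpow t - e < ws 0 s t & forall s', uniq s' ->
    (forall k, k \in s' -> (\max_(j <- s) j < k)%N) -> ws (size s) s' t <= e].
Proof.
move=> td e0; have [s us ts] : exists2 s, uniq s & dpow t - e < ws 0 s t.
  by apply: wsum_ltdpow => //; rewrite ltrBlDr ltrDl.
exists s; split=> // s' us' ss'.
have us3 : uniq (s ++ s').
  rewrite cat_uniq us us' andbT/=; apply/hasPn => k ks'.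
  by apply/negP => /leq_max_seq; rewrite leqNgt ss'.
by have := dwp_wsum td us3; rewrite wsum_cat add0n; lra.
Qed.

(** Behind a near-optimal list the tail is at most e / 2 with weights shifted by [size s]; far out x
    is so flat that undoing the shift costs at most e / 2. *)
Lemma dwp_tail x (e : R) : dwp w p x -> 0 < e -> exists L, forall s, uniq s ->
  ws 0 s (cut (fun k => L <= k)%N x) <= e.
Proof.
move=> xd e0; have e20 : 0 < e / 2 by rewrite divr_gt0.
have [s [us _ stail]] := wsum_near_optimal xd e20.
have [eta /andP[eta0 _] Heta] := small_powR (size s) e20.
have [N _ HN] : \forall n \near \oo, `|x n| <= eta.
  by move: (dwp_cvg0 xd) => /cvgr0Pnorm_le; exact.
exists (maxn N (\max_(j <- s) j).+1) => t ut.
have := wsum_filter p1 wS 0 t (fun k => maxn N (\max_(j <- s) j).+1 <= k)%N x.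
set s' := [seq k <- t | _] => h1.
have us' : uniq s' by rewrite filter_uniq.
have s'N k : k \in s' -> (N <= k)%N /\ (\max_(j <- s) j < k)%N.
  by rewrite mem_filter geq_max => /andP[/andP[]].
have h2 := stail s' us' (fun k ks => (s'N k ks).2).
have xS k : k \in s' -> `|x k| `^ p <= eta `^ p.
  by move=> /s'N[Nk _]; rewrite ler_powRp// HN.
have := wsum_shift w_ge0 w_le1 wS 0 (size s) (powR_ge0 eta p) xS.
rewrite add0n; lra.
Qed.

(* A near-optimal finite list [s] for [t] leaves almost no room for [t] beyond [s], while a flat
   vector loses little when its rearrangement is shifted by [size s]. *)
Lemma dpow_flat_add t (d : R) : dwp w p t -> 0 < d -> exists L (e : R), 0 < e /\
  forall t', dwp w p t' -> d <= dpow t' ->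
    (forall k, (k < L)%N -> `|t' k| <= e) -> (forall k, `|t' k| <= e) ->
    dpow t + d / (8 * 2 `^ p) <= dpow (fun k => t k + t' k).
Proof.
move=> td d0; set K := 2 `^ p; have K1 : 1 <= K by exact: powR2_ge1.
have K0 : 0 < K by exact: lt_le_trans K1.
have e0 : 0 < d / (24 * K) by rewrite divr_gt0// mulr_gt0.
(* Three losses of e occur: near-optimality of s, the perturbation of t on s, and t on s3. The gain
   d / (4 * K) = 6 * e leaves 3 * e = d / (8 * K). *)
have [e eE] : exists e, e = d / (24 * K) by exists (d / (24 * K)).
rewrite -eE in e0.
have [s [us ts stail]] := wsum_near_optimal td e0.
set L := (\max_(k <- s) k).+1.
have [eta1 eta10 H1] := wsum_near p1 w 0 s t e0.
have d80 : 0 < d / 8 by rewrite divr_gt0.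
have [eta2 /andP[eta20 _] H2] := small_powR L d80.
have [eta3 /andP[eta30 _] H3] := small_powR (size s) d80.
exists L, (Num.min eta1 (Num.min eta2 eta3)).
split; first by rewrite !lt_min eta10 eta20 eta30.
move=> t' t'd dt' t'L t'e.
have [s2 us2 ts2] : exists2 s2, uniq s2 & d / 2 < ws 0 s2 t'.
  by apply: (wsum_ltdpow t'd); apply: lt_le_trans dt'; move: d0; lra.
pose s3 := [seq k <- s2 | (L <= k)%N].
have us3 : uniq (s ++ s3).
  rewrite cat_uniq us filter_uniq// andbT/=; apply/hasPn => k.
  by rewrite mem_filter => /andP[Lk _]; apply/negP => /leq_max_seq; rewrite leqNgt Lk.
have tail : ws (size s) s3 t <= e.
  by apply: stail => [|k]; rewrite ?filter_uniq// mem_filter => /andP[].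
have near : ws 0 s t - e <= ws 0 s (fun k => t k + t' k).
  have /H1 : forall k, k \in s -> `|t' k| <= eta1.
    by move=> k _; have := t'e k; rewrite le_min => /andP[].
  by rewrite ler_distl => /andP[].
(* Of d / 2, at most d / 8 is lost below L and at most d / 8 to the shift by [size s]. *)
have big : d / 4 <= ws (size s) s3 t'.
  have := wsum_split p1 w 0 s2 (fun k => L <= k)%N t'.
  have := wsum_filter p1 wS 0 s2 (fun k => L <= k)%N t'.
  have e3 k : k \in s3 -> `|t' k| `^ p <= eta3 `^ p.
    by move=> _; rewrite ler_powRp//; have := t'e k; rewrite !le_min => /and3P[].
  have := wsum_shift w_ge0 w_le1 wS 0 (size s) (powR_ge0 eta3 p) e3.
  rewrite add0n.
  have := @wsum_cut_lt s2 t' L eta2 us2 (ltW eta20).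
  have -> : cut (predC (fun k => L <= k)%N) t' = cut (fun k => k < L)%N t'.
    by apply/funext => k; rewrite /cut/= -ltnNge.
  have t'2 k : (k < L)%N -> `|t' k| <= eta2.
    by move=> _; have := t'e k; rewrite !le_min => /and3P[].
  by move=> /(_ t'2); rewrite -/s3; move: ts2 H2 H3; lra.
have sub : ws (size s) s3 t' <= K * (ws (size s) s3 (fun k => t k + t' k) + ws (size s) s3 t).
  rewrite mulrDr; apply: wsum_comb2; first exact: w_ge0.
  move=> k _; rewrite -mulrDr.
  rewrite [X in `|X| `^ p <= _](_ : t' k = (t k + t' k) + - t k); last by ring.
  by apply: le_trans (powRD_le p1 _ _) _; rewrite normrN.
have [ttd _] := dwpD td t'd.
apply: le_trans (dwp_wsum ttd us3); rewrite wsum_cat add0n.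
set b := ws (size s) s3 (fun k => t k + t' k) in sub *.
have : d / (4 * K) <= b + e.
  rewrite ler_pdivrMr ?mulr_gt0//.
  have : d / 4 <= K * (b + e).
    by apply: le_trans big (le_trans sub _); rewrite ler_wpM2l ?(ltW K0)// lerD2l.
  by move: K0; nra.
have -> : d / (8 * K) = 3 * e by rewrite eE; field; rewrite gt_eqF.
have -> : d / (4 * K) = 6 * e by rewrite eE; field; rewrite gt_eqF.
move: near ts; lra.
Qed.

Lemma lp_tail z (e : R) : lp p z -> 0 < e -> exists L, forall N,
  \sum_(i < N) `|z (L + i)%N| `^ p <= e.
Proof.
move=> zl e0.
have [L HL] : exists L, lpow z - e < \sum_(i < L) `|z i| `^ p.
  apply: contrapT => H; suff : lpow z <= lpow z - e by rewrite lerBrDr gerDl leNgt e0.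
  apply: (sum_lp _).2 => N; rewrite leNgt; apply/negP => NH.
  by apply: H; exists N.
exists L => N; have := lp_sum (L + N) zl.
rewrite big_split_ord /=; move: HL; lra.
Qed.

(** The coefficient 1 of [lpow z] is the point: it keeps N successive additions linear in N. On the
    first L coordinates z' is a perturbation costing 1; beyond L the power of z is at most 1, and
    only there is the factor 2^p paid. *)
Lemma lpow_near_add z : lp p z -> exists L (eta : R), [/\ 0 < eta,
  forall k, (L <= k)%N -> `|z k| <= 1 &
  forall z', lp p z' -> (forall k, (k < L)%N -> `|z' k| <= eta) ->
    lpow (fun k => z k + z' k) <= lpow z + 1 + 2 `^ p * (1 + lpow z')].
Proof.
move=> zl; have [L HL] := lp_tail zl ltr01.
have [eta eta0 H] := wsum_near p1 (fun=> 1) 0 (iota 0 L) z (@ltr01 R).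
exists L, eta; split => // [k Lk|z' z'l z'L].
  apply: (le_of_powRp_le p1) => //; apply: le_trans (HL (k - L).+1).
  by rewrite big_ord_recr /= subnKC// lerDr sumr_ge0// => i _; exact: powR_ge0.
apply: (sum_lp _).2 => N.
set f := fun k => `|z k + z' k| `^ p.
apply: (@le_trans _ _ (\sum_(i < L + N) f i)).
  rewrite addnC big_split_ord /= lerDl; apply: sumr_ge0 => i _; exact: powR_ge0.
rewrite big_split_ord /= lerD//.
  have /H : forall k, k \in iota 0 L -> `|z' k| <= eta.
    by move=> k; rewrite mem_iota => /andP[_]; exact: z'L.
  rewrite !wsum1 /f -(big_mkord xpredT (fun k => `|z k + z' k| `^ p)).
  have := lp_sum L zl; rewrite -(big_mkord xpredT (fun k => `|z k| `^ p)).
  by rewrite /index_iota subn0 ler_distl => A /andP[_ B]; move: A B; lra.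
apply: (@le_trans _ _ (\sum_(i < N) 2 `^ p * (`|z (L + i)%N| `^ p + `|z' (L + i)%N| `^ p))).
  by apply: ler_sum => i _; exact: powRD_le.
rewrite -mulr_sumr ler_wpM2l ?powR_ge0// big_split; apply: lerD; first exact: HL.
have := lp_sum (L + N) z'l; rewrite big_split_ord /=; apply: le_trans.
by rewrite lerDr sumr_ge0// => i _; exact: powR_ge0.
Qed.

(** * Vectors extracted from the failure of compactness *)

Section NonCompact.
Variables (A B T : seqR R -> seqR R).
Hypotheses (AL : Ld w p A) (BL : Ldl w p B)
  (TE : forall x, dwp w p x -> T x = A (B x)).

Lemma factor_Ld : Ld w p T.
Proof.
have [A1 A2 [CA CA0 A3]] := (LdP A).1 AL; have [B1 B2 [CB CB0 B3]] := LdlP BL.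
have Bd x : dwp w p x -> dwp w p (B x) by move=> /B1 /lp_dwp[].
apply/LdP; split => [x xd|a x y xd yd|].
  by rewrite (TE xd); exact: A1 _ (Bd _ xd).
  rewrite (TE xd) (TE yd) (TE (dwpD (dwpZ a xd).1 yd).1) (B2 _ _ _ xd yd).
  exact: A2 (Bd _ xd) (Bd _ yd).
exists (CA * CB); first exact: mulr_ge0.
move=> x xd; rewrite (TE xd) (le_trans (A3 _ (Bd _ xd)))// -mulrA ler_wpM2l//.
exact: le_trans (lp_dwp (B1 _ xd)).2 (B3 _ xd).
Qed.

Definition almost_block (C d : R) L (eta : R) y :=
  [/\ dwp w p y, dpow y <= C,
    forall k, (k < L)%N -> [/\ `|y k| <= eta, `|B y k| <= eta & `|T y k| <= eta] &
    d <= dpow (T y)].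

Hypothesis Tnc : ~ compact_op w p T.

(** Along one ultrafilter u_n, B u_n and T u_n converge coordinatewise, so differences u_n - u_m and
    their images are small on initial blocks. If T u_n also came arbitrarily close in norm to its
    coordinatewise limit t, a subsequence would converge, against non-compactness. *)
Lemma almost_blocks : exists C d, 0 < d /\
  forall L eta, 0 < eta -> exists y, almost_block C d L eta y.
Proof.
have [T1 T2 [CT CT0 T3]] := (LdP T).1 factor_Ld.
have [B1 B2 [CB CB0 B3]] := LdlP BL.
have Bd x : dwp w p x -> dwp w p (B x) /\ dpow (B x) <= CB * dpow x.
  move=> xd; have [? H] := lp_dwp (B1 _ xd); split=> //.
  exact: le_trans H (B3 _ xd).
have [u [ud [M uM] un]] : exists u : nat -> seqR R, [/\ (forall m, dwp w p (u m)),
    (exists M : R, forall m, dpow (u m) <= M) &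
    ~ exists (phi : nat -> nat) (y : seqR R),
      [/\ (forall m, (phi m < phi m.+1)%N), dwp w p y &
          (fun m => dnorm w p (fun k => T (u (phi m)) k - y k)) @ \oo --> (0 : R)]].
  apply: contrapT => H; apply: Tnc => u ud [M uM].
  apply: contrapT => H2; apply: H; exists u; split => //.
  exists (`|M| `^ p * 1) => m; apply: powR_root_le => //; first exact: dpow_ge0.
  by rewrite powR1 mulr1 -dnormE; exact: uM.
have coord x (c : R) k : dwp w p x -> dpow x <= c -> `|x k| <= Num.max 1 c.
  move=> xd xc; apply: (le_of_powRp_le p1); first by rewrite le_max lexx.
  by rewrite (le_trans (dwp_norm_le k xd))// le_max xc orbT.
have [F [FU Foo]] := @ultraFilterLemma nat \oo _.
have FF : ProperFilter F := @ultra_proper _ _ FU.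
have limF (v : nat -> seqR R) (c : R) : (forall n, dwp w p (v n) /\ dpow (v n) <= c) ->
    exists l : seqR R, forall k, v n k @[n --> F] --> l k.
  move=> vc; have H k : exists l : R, v n k @[n --> F] --> l.
    apply: ultra_bounded_cvg => n; have [vd vb] := vc n; exact: coord vd vb.
  by have [l Hl] := choice H; exists l.
have [x Hx] := limF u M (fun n => conj (ud n) (uM n)).
have Tb n : dwp w p (T (u n)) /\ dpow (T (u n)) <= CT * M.
  by split; [exact: T1|rewrite (le_trans (T3 _ (ud n)))// ler_wpM2l].
have Bb n : dwp w p (B (u n)) /\ dpow (B (u n)) <= CB * M.
  have [h1 h2] := Bd _ (ud n); split=> //.
  by rewrite (le_trans h2)// ler_wpM2l.
have [b Hb] := limF _ _ Bb; have [t Ht] := limF _ _ Tb.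
have [td _] : dwp w p t /\ dpow t <= CT * M.
  by apply: (dwp_lim Ht); exact: filterE.
have [d d0 Hd] : exists2 d : R, 0 < d &
    F [set n | d <= dpow (fun k => T (u n) k - t k)].
  apply: contrapT => H; apply: un.
  have {}H m N : exists n, (N <= n)%N /\ dpow (fun k => T (u n) k - t k) <= (m.+1%:R^-1) `^ p.
    have [FA|FA] := in_ultra_setVsetC
        [set n | dpow (fun k => T (u n) k - t k) <= (m.+1%:R^-1) `^ p] FU.
      have : F [set n | (N <= n)%N] by apply: Foo; exists N.
      by move=> FN; have [n [? ?]] := filter_ex (filterI FN FA); exists n.
    exfalso; apply: H; exists ((m.+1%:R^-1) `^ p).
      by rewrite powR_gt0// invr_gt0 ltr0n.
    by apply: filterS FA => n /= /negP; rewrite -ltNge => /ltW.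
  have {}H (q : nat * nat) : exists n, (q.2 <= n)%N /\
      dpow (fun k => T (u n) k - t k) <= (q.1.+1%:R^-1) `^ p by exact: H.
  have [f Hf] := choice H.
  (* [f (m, N)] is an index at least N at which T u is within 1 / (m + 1) of t; the recursion makes
     the indices strictly increasing. *)
  pose phi := fix phi m := if m is m'.+1 then f (m, (phi m').+1) else f (0, 0).
  exists phi, t; split=> // [m|]; first by have [] := Hf (m.+1, (phi m).+1).
  have Hphi m : dpow (fun k => T (u (phi m)) k - t k) <= (m.+1%:R^-1) `^ p.
    by case: m => [|m]; [have [] := Hf (0, 0)|have [] := Hf (m.+1, (phi m).+1)].
  apply: (@squeeze_cvgr _ _ _ _ (fun=> 0) (@harmonic R)); first last.
  - exact: cvg_harmonic.
  - exact: cvg_cst.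
  apply: nearW => m; rewrite dnormE powR_ge0/=.
  rewrite (@le_trans _ _ (((m.+1%:R^-1) `^ p) `^ p^-1))//.
    by rewrite ge0_ler_powR ?invr_ge0 ?(ltW p0)// ?nnegrE ?powR_ge0 ?dpow_ge0//; exact: Hphi.
  by rewrite -powRrM divff ?gt_eqF// powRr1// invr_ge0.
exists (2 `^ p * (M + M)), (d / 2); split; first by rewrite divr_gt0.
move=> L eta eta0; have eta20 : 0 < eta / 2 by rewrite divr_gt0.
have FL : F [set n | forall k, (k < L)%N -> [/\ `|x k - u n k| <= eta / 2,
    `|b k - B (u n) k| <= eta / 2 & `|t k - T (u n) k| <= eta / 2]].
  apply: near_all_lt => k.
  have /cvgrPdist_le/(_ _ eta20) h1 := Hx k.
  have /cvgrPdist_le/(_ _ eta20) h2 := Hb k.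
  have /cvgrPdist_le/(_ _ eta20) h3 := Ht k.
  by apply: filterS3 h1 h2 h3 => n.
have [n [nL nd]] := filter_ex (filterI FL Hd).
have Ttd := (dwpB (Tb n).1 td).1.
have [s us ds] : exists2 s, uniq s & d / 2 < ws 0 s (fun k => T (u n) k - t k).
  by apply: (wsum_ltdpow Ttd); apply: lt_le_trans nd; move: d0; lra.
(* Now n is fixed and m runs along F: the list s records more than d / 2 of T u_n - t, and T u_m
   tends to t on s. *)
have : ws 0 s (fun k => T (u n) k - T (u m) k) @[m --> F] --> ws 0 s (fun k => T (u n) k - t k).
  by apply: wsum_cvg => // k _; apply: cvgB; [exact: cvg_cst|exact: Ht].
move=> /cvgr_gt/(_ _ ds) Fs.
have [m [mL ms]] := filter_ex (filterI FL Fs).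
have E : (fun k => -1 * u m k + u n k) = (fun k => u n k - u m k).
  by apply/funext => k; ring.
have TD : T (fun k => -1 * u m k + u n k) = (fun k => T (u n) k - T (u m) k).
  by rewrite (T2 _ _ _ (ud m) (ud n)); apply/funext => k; ring.
have BD : B (fun k => -1 * u m k + u n k) = (fun k => B (u n) k - B (u m) k).
  by rewrite (B2 _ _ _ (ud m) (ud n)); apply/funext => k; ring.
have [yd yM] := dwpB (ud n) (ud m).
rewrite E in TD BD; exists (fun k => u n k - u m k); split; rewrite ?TD ?BD //.
- by rewrite (le_trans yM)// ler_wpM2l ?powR_ge0// lerD.
- move=> k kL; have [m1 m2 m3] := mL k kL; have [n1 n2 n3] := nL k kL.
  have D (a a1 a2 : R) : `|a - a1| <= eta / 2 -> `|a - a2| <= eta / 2 -> `|a2 - a1| <= eta.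
    move=> h1 h2; rewrite (_ : a2 - a1 = (a - a1) - (a - a2)); last by clear; ring.
    by rewrite (splitr eta) (le_trans (ler_normB _ _))// lerD.
  by split; apply: D; eassumption.
- apply: ltW; apply: lt_le_trans ms _.
  exact: dwp_wsum (dwpB (Tb n).1 (Tb m).1).1 us.
Qed.

Lemma mean_w_small (e : R) : 0 < e -> exists2 N : nat, (0 < N)%N &
  \sum_(i < N) w i <= e * N%:R /\ w N <= e.
Proof.
move=> e0; have e20 : 0 < e / 2 by rewrite divr_gt0.
have /cvgr0Pnorm_le/(_ _ e20) := lw_cvg0 lw; move=> [M _ HM].
(* The first M weights contribute at most M <= e N / 2, the others at most e / 2 each. *)
pose N := (M + (Num.trunc (2 * M%:R / e)).+1)%N.
exists N; first by rewrite /N addnS.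
have wM n : (M <= n)%N -> w n <= e / 2.
  by move=> Mn; rewrite (le_trans (ler_norm _))// HM.
split; last by rewrite (le_trans (wM _ (leq_addr _ _)))//; move: e0; lra.
have NM : 2 * M%:R / e <= N%:R.
  by rewrite /N natrD (le_trans (ltW (truncnS_gt _)))// lerDr ler0n.
rewrite ler_pdivrMr// in NM.
rewrite {1}/N big_split_ord /=.
have h1 : \sum_(i < M) w i <= M%:R.
  apply: (@le_trans _ _ (\sum_(i < M) 1)); last by rewrite sumr_const card_ord.
  by apply: ler_sum => i _; exact: w_le1.
have h2 : \sum_(i < (Num.trunc (2 * M%:R / e)).+1) w (M + i)%N <=
    (Num.trunc (2 * M%:R / e)).+1%:R * (e / 2).
  apply: (@le_trans _ _ (\sum_(i < (Num.trunc (2 * M%:R / e)).+1) (e / 2))).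
    by apply: ler_sum => i _; rewrite wM// leq_addr.
  by rewrite sumr_const card_ord -[leLHS]mulr_natl.
have h3 : (Num.trunc (2 * M%:R / e)).+1%:R <= N%:R :> R.
  by rewrite ler_nat leq_addl.
move: h1 h2 h3 NM e0; nra.
Qed.

Definition lin_on (S : seqR R -> seqR R) := forall (a : R) x y, dwp w p x -> dwp w p y ->
  S (fun k => a * x k + y k) = (fun k => a * S x k + S y k).

Lemma lin_onD S x y : lin_on S -> dwp w p x -> dwp w p y ->
  S (fun k => x k + y k) = (fun k => S x k + S y k).
Proof.
move=> SL xd yd; have := SL 1 x y xd yd; under eq_fun do rewrite mul1r.
by under [in RHS]eq_fun do rewrite mul1r.
Qed.

Lemma lin_on0 S : lin_on S -> S (fun=> 0) = (fun=> 0).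
Proof.
move=> SL; have := SL (-1) _ _ dwp0.1 dwp0.1.
under eq_fun do rewrite mulr0 addr0.
by move=> ->; apply/funext => k; ring.
Qed.

Lemma coord_le x (b : R) k : 1 <= b -> dwp w p x -> dpow x <= b -> `|x k| <= b.
Proof.
move=> b1 xd xb; apply: (le_of_powRp_le p1) => //.
exact: le_trans (dwp_norm_le k xd) xb.
Qed.

(* If the vectors could be chosen with [T y] arbitrarily flat, a sum [Y] of [N] of them would have
   [dpow (T Y)] of order at least [N], while [B Y] is bounded in the sup norm and has [lpow (B Y)]
   of order at most [N], so that [dpow (B Y) = o(N)] because the weights tend to 0. *)
Lemma not_flat (C d : R) : 0 < d ->
  ~ (forall L (eta e : R), 0 < eta -> 0 < e -> exists y, almost_block C d L eta y /\
       forall k, `|T y k| <= e).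
Proof.
move=> d0 flat.
have [T1 T2 _] := (LdP T).1 factor_Ld.
have [A1 A2 [CA CA0 A3]] := (LdP A).1 AL.
have [B1 B2 [CB CB0 B3]] := LdlP BL.
set K := (2 : R) `^ p; have K0 : 0 < K by rewrite powR_gt0.
pose b := 1 + CB * `|C|.
have b1 : 1 <= b by rewrite lerDl mulr_ge0.
pose C1 := 1 + K * (1 + b); pose c := d / (8 * K).
have c0 : 0 < c by rewrite divr_gt0// mulr_gt0.
have C10 : 0 <= C1 by rewrite addr_ge0// mulr_ge0 ?(ltW K0)// addr_ge0// (le_trans ler01).
(* A new vector adds at most 1 / N to [B Y] below L2; elsewhere the old [B Y] is at most 1 and the
   bound starts afresh at 1 + b. After N steps the sup norm is at most 2 + b. *)
have sums N : (0 < N)%N -> forall i : nat, exists Y, [/\ dwp w p Y, c * i%:R <= dpow (T Y),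
    lpow (B Y) <= C1 * i%:R & forall k, `|B Y k| <= 1 + b + i%:R / N%:R].
  move=> N0; elim=> [|i [Y [Yd TY lY sY]]].
    have [z1 z2] := dwp0; exists (fun=> 0).
    have l0 : lpow (B (fun=> 0)) <= 0 by have := B3 _ z1; rewrite z2 mulr0.
    split=> //; rewrite ?mulr0 ?dpow_ge0// => k; rewrite mul0r addr0.
    have [Bd Bl] := lp_dwp (B1 _ z1).
    have b1' : 1 <= 1 + b by rewrite lerDl (le_trans ler01).
    apply: (coord_le _ b1') => //.
    by rewrite (le_trans Bl)// (le_trans l0)// (le_trans ler01).
  have [L1 [e1 [e10 H1]]] := dpow_flat_add (T1 _ Yd) d0.
  have [L2 [eta2 [eta20 sZ H2]]] := lpow_near_add (B1 _ Yd).
  have N0' : (0 : R) < N%:R^-1 by rewrite invr_gt0 ltr0n.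
  have eta0 : 0 < Num.min e1 (Num.min eta2 N%:R^-1) by rewrite !lt_min e10 eta20.
  have [y [[yd yC yL Ty] ye]] := flat (maxn L1 L2) _ _ eta0 e10.
  have ly : lpow (B y) <= b.
    apply: (le_trans (B3 _ yd)); apply: (@le_trans _ _ (CB * `|C|)); last by rewrite lerDr.
    by rewrite ler_wpM2l// (le_trans yC)// ler_norm.
  have [Byd Byl] := lp_dwp (B1 _ yd).
  exists (fun k => Y k + y k).
  rewrite (lin_onD T2 Yd yd) (lin_onD B2 Yd yd); split.
  - exact: (dwpD Yd yd).1.
  - rewrite -natr1 mulrDr mulr1; apply: le_trans (H1 _ (T1 _ yd) Ty _ ye).
      by rewrite lerD2r.
    move=> k kL; have [|_ _] := yL k; first by rewrite leq_max kL.
    by rewrite le_min => /andP[].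
  - apply: (le_trans (H2 _ (B1 _ yd) _)).
      move=> k kL; have [|_ + _] := yL k; first by rewrite leq_max kL orbT.
      by rewrite !le_min => /and3P[].
    rewrite -[i.+1%:R]natr1 [C1 * _]mulrDr mulr1 -addrA lerD// /C1 lerD2l ler_wpM2l ?(ltW K0)//.
    by rewrite lerD2l.
  - move=> k; apply: (le_trans (ler_normD _ _)).
    have [kL|Lk] := ltnP k L2.
      have [|_ + _] := yL k; first by rewrite leq_max kL orbT.
      rewrite !le_min => /and3P[_ _ h]; rewrite -natr1 mulrDl div1r addrA.
      by rewrite lerD.
    rewrite -[leLHS]addr0 lerD ?divr_ge0// lerD ?sZ//.
    by apply: coord_le => //; exact: le_trans Byl ly.
pose S := (2 + b) `^ p; have S0 : 0 <= S by exact: powR_ge0.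
have q0 : 0 < 1 + CA * (S + C1) by rewrite ltr_pwDl// mulr_ge0// addr_ge0.
(* At this level CA * (S + C1) * e is smaller than c, while the estimates for N vectors give the
   opposite inequality. *)
have e0 : 0 < c / (1 + CA * (S + C1)) by rewrite divr_gt0.
have [N N0 [WN wN]] := mean_w_small e0.
have [Y [Yd TY lY sY]] := sums N N0 N.
set e := c / _ in e0 WN wN.
have N0' : (0 : R) < N%:R by rewrite ltr0n.
have BY : dpow (B Y) <= S * (e * N%:R) + e * (C1 * N%:R).
  apply: (wsum_dwp _).2 => s us.
  have xS k : `|B Y k| `^ p <= S.
    rewrite ler_powRp//; apply: (le_trans (sY k)).
    by rewrite divff ?gt_eqF//; lra.
  have lYs := le_trans (lp_sum_uniq (B1 _ Yd) us) lY.
  apply: le_trans (wsum_split_le w_ge0 wS N S0 xS lYs) _.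
  by rewrite lerD ?ler_wpM2l// ler_wpM2r// mulr_ge0// ltW.
have := TY; rewrite (TE Yd) => h1.
have h2 := A3 _ (lp_dwp (B1 _ Yd)).1.
have h3 : CA * dpow (B Y) <= CA * (S * (e * N%:R) + e * (C1 * N%:R)) by rewrite ler_wpM2l.
have h4 : c * N%:R <= CA * (S + C1) * e * N%:R.
  apply: le_trans h1 (le_trans h2 (le_trans h3 _)).
  by rewrite le_eqVlt; apply/orP; left; apply/eqP; ring.
rewrite ler_pM2r// in h4.
have h5 : e * (1 + CA * (S + C1)) = c by rewrite /e divfK// gt_eqF.
move: h4; rewrite -{1}h5; lra.
Qed.

(** By [not_flat], some level e of flatness is unattainable past some L0 and eta0; every almost
    block chosen past these has a coordinate of T y at least e. *)
Lemma peaks : exists C e : R, 0 < e /\ forall L (eta : R), 0 < eta -> exists y,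
  [/\ dwp w p y, dpow y <= C, forall k, (k < L)%N -> `|y k| <= eta /\ `|T y k| <= eta &
    exists k, e <= `|T y k|].
Proof.
have [C [d [d0 blocks]]] := almost_blocks.
apply: contrapT => H; apply: (@not_flat C d d0) => L0 eta0 e0 eta00 e00.
apply: contrapT => H2; apply: H; exists C, e0; split=> // L eta eta_gt0.
have m0 : 0 < Num.min eta eta0 by rewrite lt_min eta_gt0.
have [y [yd yC yL Ty]] := blocks (maxn L L0) _ m0.
exists y; split=> //.
  move=> k kL; have [|h1 _ h2] := yL k; first by rewrite leq_max kL.
  by move: h1 h2; rewrite !le_min => /andP[-> _] /andP[-> _].
apply: contrapT => H3; apply: H2; exists y; split.
  split=> // k kL; have [|h1 h2 h3] := yL k; first by rewrite leq_max kL orbT.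
  by move: h1 h2 h3; rewrite !le_min => /andP[_ ->] /andP[_ ->] /andP[_ ->].
move=> k; rewrite leNgt; apply/negP => h; apply: H3; exists k; exact: ltW.
Qed.

(** * The biorthogonal system *)

(* [P] stands for the finite rank map [x |-> \sum_(i < n) phi_i(x) y_i] built from the first [n]
   steps, with [phi_i (T y_j) = (i == j)]. A step takes a [y0] with a large coordinate [k] of [T y0],
   sets [y = y0 - P (T y0)] and [phi x = (x - T (P x))_k / (T y)_k]. The biorthogonality is then exact, so
   that no perturbation of the identity has to be inverted. *)
Record proj_ok (P : seqR R -> seqR R) : Prop := ProjOk {
  proj_dwp : forall x, dwp w p x -> dwp w p (P x);
  proj_lin : lin_on P;
  proj_cont : exists L0 (M : R), 0 <= M /\ forall x (eta : R), dwp w p x -> 0 <= eta ->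
    (forall k, (k < L0)%N -> `|x k| <= eta) -> dpow (P x) <= M * eta `^ p;
  proj_tail : forall e : R, 0 < e -> exists L, forall x (eta : R), dwp w p x -> 0 <= eta ->
    (forall k, `|x k| <= eta) -> forall k, (L <= k)%N -> `|T (P x) k| <= e * eta;
  proj_idem : forall x, dwp w p x -> P (T (P x)) = P x
}.

(** The n-th block [L, L') contains the peak k, which makes the peaks distinct. The bound in
    [step_out] cancels the factor (2^p)^(n+1) of [quasi_sum]; the errors in [step_coord] form a
    sequence in l_p. *)
Record proj_step (C Cphi : R) (n : nat) (P P' : seqR R -> seqR R) (L L' k : nat)
    (y : seqR R) (phi : seqR R -> R) : Prop := ProjStep {
  step_k : (L <= k < L')%N;
  step_dwp : dwp w p y;
  step_dpow : dpow y <= C;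
  step_out : forall s, uniq s ->
    ws 0 s (cut (fun i => ~~ (L <= i < L')%N) y) <= ((2^-1) ^+ n.+1) `^ p;
  step_kill : P (T y) = fun=> 0;
  step_one : phi (T y) = 1;
  step_zero : forall x, dwp w p x -> phi (T (P x)) = 0;
  step_lin : forall (a : R) x z, dwp w p x -> dwp w p z ->
    phi (fun j => a * x j + z j) = a * phi x + phi z;
  step_next : forall x, dwp w p x -> P' x = fun j => phi x * y j + P x j;
  step_coord : exists2 c : R, `|c| <= Cphi & forall x (eta : R), dwp w p x ->
    (forall j, `|x j| <= eta) -> `|phi x - c * x k| <= (2^-1) ^+ n.+1 * eta
}.

Lemma proj_ok0 : proj_ok (fun _ _ => 0).
Proof.
have [z1 z2] := dwp0; have T0 := lin_on0 (let: And3 _ l _ := (LdP T).1 factor_Ld in l).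
split=> //.
- by move=> a x y _ _; apply/funext => k; ring.
- by exists 0%N, 0; split=> // x eta _ _ _; rewrite z2 mul0r.
- move=> e e0; exists 0%N => x eta _ eta0 _ k _.
  by rewrite T0 normr0 mulr_ge0// ltW.
Qed.

(** The correction P (T y0) is small because P is controlled by the first L0 coordinates, where T y0
    is small; T (P x) is negligible at k0 by [proj_tail]. The constants are uniform in n: the
    correction has power at most 1, giving K * (1 + C), and |(T y)_k| >= e / 2 gives 2 / e. *)
Lemma proj_step_exists : exists C Cphi : R, forall n P L, proj_ok P ->
  exists P' L' k y phi, proj_ok P' /\ proj_step C Cphi n P P' L L' k y phi.
Proof.
have [T1 T2 [CT CT0 T3]] := (LdP T).1 factor_Ld.
have [C [e [e0 Hpeak]]] := peaks.
set K := (2 : R) `^ p; have K1 : 1 <= K by exact: powR2_ge1.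
have K0 : 0 < K by exact: lt_le_trans K1.
exists (K * (1 + C)), (2 / e) => n P L [P1 P2 [L0 [M [M0 P3]]] P4 P5].
have TP0 := lin_on0 T2.
pose h : R := (2^-1) ^+ n.+1.
have h0 : 0 < h by rewrite exprn_gt0// invr_gt0.
have e20 : 0 < e / 2 by rewrite divr_gt0.
have he0 : 0 < h * (e / 2) by rewrite mulr_gt0.
have [L1 HL1] := P4 _ he0.
pose Lm := maxn L (maxn L0 L1).
(* Three targets: (e / 2)^p for T (P (T y0)) at the peak, 1 for the power of P (T y0), and h^p / 2
   for the part of y below Lm. The number m below dominates the multiples of eta^p that these
   require. *)
have d0 : 0 < Num.min ((e / 2) `^ p) (Num.min 1 (h `^ p / 2)).
  by rewrite !lt_min ltr01 powR_gt0// divr_gt0// powR_gt0.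
pose m := (Num.trunc (CT * M + M + K * (Lm%:R + M))).+1.
have [eta1 /andP[eta10 _] Heta1] := small_powR m d0.
pose eta := Num.min eta1 (e / 4).
have eta0 : 0 < eta by rewrite lt_min eta10 divr_gt0.
have etae : eta <= e / 4 by rewrite ge_min lexx orbT.
have mge : CT * M + M + K * (Lm%:R + M) <= m%:R by exact/ltW/truncnS_gt.
have Heta : (CT * M + M + K * (Lm%:R + M)) * eta `^ p <=
    Num.min ((e / 2) `^ p) (Num.min 1 (h `^ p / 2)).
  apply: le_trans Heta1; apply: ler_pM => //; rewrite ?powR_ge0//.
    by rewrite !addr_ge0// mulr_ge0// ?addr_ge0// ltW.
  by rewrite ler_powRp// ?(ltW eta0)// ge_min lexx.
move: Heta; rewrite !le_min => /and3P[Heta_e Heta_1 Heta_h].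
have ep0 : 0 <= eta `^ p by exact: powR_ge0.
have KLM0 : 0 <= K * (Lm%:R + M) by rewrite mulr_ge0 ?addr_ge0// ltW.
have CTM0 : 0 <= CT * M by rewrite mulr_ge0.
have [y0 [y0d y0C y0L [k0 ek0]]] := Hpeak Lm eta eta0.
have Ty0d := T1 _ y0d; have PTd := P1 _ Ty0d; have TPTd := T1 _ PTd.
(* Below Lm the entries of T y0 are at most e / 4, so the peak is not there. *)
have k0L : (Lm <= k0)%N.
  rewrite leqNgt; apply/negP => /y0L[_ h1].
  by have := le_trans ek0 (le_trans h1 etae); lra.
have DPT : dpow (P (T y0)) <= M * eta `^ p.
  apply: P3 => //; first exact: ltW.
  by move=> k kL0; have [|_] := y0L k; first by rewrite !leq_max kL0 !orbT.
have PTk0 : `|T (P (T y0)) k0| <= e / 2.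
  apply: (ler_powRp_inv p1); first exact: ltW.
  apply: le_trans (dwp_norm_le k0 TPTd) _; apply: le_trans (T3 _ PTd) _.
  have : CT * dpow (P (T y0)) <= CT * (M * eta `^ p) by rewrite ler_wpM2l.
  have := mulr_ge0 M0 ep0; have := mulr_ge0 KLM0 ep0; nra.
pose y := fun j => -1 * P (T y0) j + y0 j.
have yd : dwp w p y by apply: (dwpD (dwpZ (-1) PTd).1 y0d).1.
have yle k : `|y k| `^ p <= K * `|P (T y0) k| `^ p + K * `|y0 k| `^ p.
  by rewrite -mulrDr (le_trans (powRD_le p1 _ _))// mulN1r normrN.
have yC : dpow y <= K * (1 + C).
  have [_] := dwp_comb (ltW K0) (ltW K0) PTd y0d yle.
  move=> /le_trans; apply; rewrite -mulrDr ler_wpM2l ?(ltW K0)// lerD//.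
  apply: le_trans DPT (le_trans _ Heta_1).
  by rewrite ler_wpM2r//; lra.
have Ty : T y = fun j => -1 * T (P (T y0)) j + T y0 j by exact: T2.
pose t := T y; have td : dwp w p t by exact: T1.
have tk0 : e / 2 <= `|t k0|.
  rewrite /t Ty; have := ler_normB (- T (P (T y0)) k0 + T y0 k0) (- T (P (T y0)) k0).
  rewrite normrN mulN1r (_ : _ + _ - - _ = T y0 k0); last by ring.
  lra.
have tk00 : t k0 != 0 by rewrite -normr_gt0 (lt_le_trans e20).
have Pt : P t = fun=> 0.
  rewrite /t Ty (P2 _ _ _ TPTd Ty0d) (P5 _ Ty0d).
  by apply/funext => j; ring.
pose phi x := (x k0 - T (P x) k0) / t k0.
have phi_lin (a : R) x z : dwp w p x -> dwp w p z ->
    phi (fun j => a * x j + z j) = a * phi x + phi z.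
  move=> xd zd; rewrite /phi (P2 _ _ _ xd zd) (T2 _ _ _ (P1 _ xd) (P1 _ zd)).
  by ring.
have phi1 : phi t = 1 by rewrite /phi Pt TP0 subr0 divff.
have phi0 x : dwp w p x -> phi (T (P x)) = 0.
  by move=> xd; rewrite /phi (P5 _ xd) subrr mul0r.
have c_le : `|(t k0)^-1| <= 2 / e.
  rewrite normfV -[2 / e]invrK invf_div lef_pV2// posrE// normr_gt0.
  by [].
have phi_c x (u : R) : dwp w p x -> (forall j, `|x j| <= u) ->
    `|phi x - (t k0)^-1 * x k0| <= h * u.
  move=> xd xu; have u0 : 0 <= u by apply: le_trans (xu 0); rewrite normr_ge0.
  have -> : phi x - (t k0)^-1 * x k0 = - (T (P x) k0 * (t k0)^-1).
    by rewrite /phi; ring.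
  rewrite normrN normrM.
  have h1 : `|T (P x) k0| <= h * (e / 2) * u.
    by apply: HL1 => //; rewrite (leq_trans _ k0L)// !leq_max leqnn !orbT.
  apply: (@le_trans _ _ ((h * (e / 2) * u) * (2 / e))); first exact: ler_pM.
  by rewrite le_eqVlt; apply/orP; left; apply/eqP; field; rewrite gt_eqF.
have hp20 : 0 < h `^ p / 2 by rewrite divr_gt0// powR_gt0.
have [L2 HL2] := dwp_tail yd hp20.
(* From L2 on, the tail of y has power at most h^p / 2, the other half of the off-block
   allowance. *)
pose L' := maxn L2 k0.+1.
pose P' x := fun j => phi x * y j + P x j.
have P'd x : dwp w p x -> dwp w p (P' x).
  by move=> xd; exact: (dwpD (dwpZ (phi x) yd).1 (P1 _ xd)).1.
have TP' x : dwp w p x -> T (P' x) = fun j => phi x * t j + T (P x) j.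
  by move=> xd; rewrite /P' (T2 _ _ _ yd (P1 _ xd)).
exists P', L', k0, y, phi; split; split => //.
- move=> a x z xd zd; rewrite /P' (phi_lin _ _ _ xd zd) (P2 _ _ _ xd zd).
  by apply/funext => j; ring.
(* [P'] is controlled by the coordinates that control P and by k0: in phi x, the term T (P x) at k0
   is bounded through [dpow (P x)]. *)
- pose Q := (2 / e) `^ p * (K * (1 + CT * M)).
  exists (maxn L0 k0.+1), (K * (Q * dpow y + M)); split.
    by rewrite mulr_ge0 ?(ltW K0)// addr_ge0// mulr_ge0 ?dpow_ge0//
      !mulr_ge0 ?powR_ge0 ?(ltW K0)// addr_ge0.
  move=> x u xd u0 xu.
  have DPx : dpow (P x) <= M * u `^ p.
    by apply: P3 => // k kL; apply: xu; rewrite leq_max kL.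
  have Pxd := P1 _ xd.
  have phix : `|phi x| `^ p <= Q * u `^ p.
    rewrite /phi normrM powRM// mulrC /Q -mulrA; apply: ler_pM; rewrite ?powR_ge0//.
      by rewrite ler_powRp.
    apply: le_trans (powRD_le p1 _ _) _; rewrite normrN -mulrA ler_wpM2l ?(ltW K0)//.
    rewrite mulrDl mul1r lerD//.
      by rewrite ler_powRp// xu// leq_max ltnSn orbT.
    apply: le_trans (dwp_norm_le k0 (T1 _ Pxd)) _; apply: le_trans (T3 _ Pxd) _.
    by rewrite -mulrA ler_wpM2l.
  have H k : `|P' x k| `^ p <= (K * (Q * u `^ p)) * `|y k| `^ p + K * `|P x k| `^ p.
    rewrite -mulrA -mulrDr; apply: le_trans (powRD_le p1 _ _) _.
    by rewrite ler_wpM2l ?(ltW K0)// lerD2r normrM powRM// ler_wpM2r ?powR_ge0.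
  have Qu0 : 0 <= K * (Q * u `^ p).
    by rewrite mulr_ge0 ?(ltW K0)// (le_trans _ phix)// powR_ge0.
  apply: le_trans (dwp_comb Qu0 (ltW K0) yd Pxd H).2 _.
  have : K * dpow (P x) <= K * (M * u `^ p) by rewrite ler_wpM2l// ltW.
  by move=> h1; rewrite -!mulrA -mulrDr; nra.
- move=> e1 e10; have e120 : 0 < e1 / 2 by rewrite divr_gt0.
  have [L3 HL3] := P4 _ e120.
  pose q := 2 / e + h; have q0 : 0 < q by rewrite addr_gt0// divr_gt0.
  have [N _ HN] : \forall j \near \oo, `|t j| <= e1 / 2 / q.
    by move: (dwp_cvg0 td) => /cvgr0Pnorm_le; apply; rewrite divr_gt0.
  exists (maxn L3 N) => x u xd u0 xu k; rewrite geq_max => /andP[L3k Nk].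
  rewrite (TP' _ xd); apply: le_trans (ler_normD _ _) _.
  have h1 : `|T (P x) k| <= e1 / 2 * u by exact: HL3.
  have h2 : `|phi x| <= q * u.
    have := phi_c x u xd xu => h3; rewrite -[phi x](subrK ((t k0)^-1 * x k0)).
    apply: le_trans (ler_normD _ _) _; rewrite /q mulrDl addrC lerD// normrM.
    exact: ler_pM.
  have h3 : `|phi x * t k| <= q * u * (e1 / 2 / q).
    by rewrite normrM; apply: ler_pM => //; exact: HN.
  have -> : e1 * u = q * u * (e1 / 2 / q) + e1 / 2 * u.
    by field; rewrite gt_eqF.
  exact: lerD.
(* P' t = y because phi t = 1 and P t = 0; P' (T (P x)) = P x because phi vanishes on T (P x). *)
- move=> x xd; have TPx := T1 _ (P1 _ xd).
  rewrite (TP' _ xd) /P' (phi_lin _ _ _ td TPx) phi1 (phi0 _ xd) (P2 _ _ _ td TPx) Pt (P5 _ xd).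
  by apply/funext => j; ring.
- rewrite (leq_trans _ k0L) ?leq_maxl//= leq_max ltnSn orbT//.
- move=> s us; have c1 k : `|cut (fun i => ~~ (L <= i < L')%N) y k| `^ p <=
      1 * `|cut (fun i => i < Lm)%N y k| `^ p + 1 * `|cut (fun i => L2 <= i)%N y k| `^ p.
    rewrite !mul1r /cut; case: ifPn => [|_]; last by rewrite normr0 powR0p// addr_ge0 ?powR_ge0.
    rewrite negb_and -ltnNge -leqNgt => /orP[kL|Lk].
      by rewrite (leq_trans kL) ?leq_maxl// lerDl powR_ge0.
    by rewrite (leq_trans _ Lk) ?leq_maxl// lerDr powR_ge0.
  apply: le_trans (wsum_comb2 0 w_ge0 (fun k _ => c1 k)) _; rewrite !mul1r.
  have h1 := HL2 s us; rewrite (splitr (h `^ p)) lerD//.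
  have c2 k : `|cut (fun i => i < Lm)%N y k| `^ p <=
      K * `|P (T y0) k| `^ p + K * `|cut (fun i => i < Lm)%N y0 k| `^ p.
    rewrite /cut; case: ifPn => _; first exact: yle.
    by rewrite !normr0 !powR0p// mulr0 addr0 mulr_ge0 ?powR_ge0.
  apply: le_trans (wsum_comb2 0 w_ge0 (fun k _ => c2 k)) _.
  have h2 := dwp_wsum PTd us.
  have h3 : ws 0 s (cut (fun i => i < Lm)%N y0) <= Lm%:R * eta `^ p.
    by apply: wsum_cut_lt => //; [exact: ltW|move=> k /y0L[]].
  apply: le_trans Heta_h; rewrite -mulrDr.
  apply: (@le_trans _ _ (K * (Lm%:R + M) * eta `^ p)); last by rewrite ler_wpM2r// lerDr addr_ge0.
  by rewrite -mulrA ler_wpM2l ?(ltW K0)// mulrDl addrC lerD// (le_trans h2).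
- by exists (t k0)^-1.
Qed.

(** For n < m, y_n = P_m (T y_n), and phi_m vanishes on the range of T P_m. For m < n, phi_m (T (P_n
    x)) = phi_m x, and P_n kills T y_n. *)
Lemma biorthogonal_sequence : exists (C Cphi : R) (L k : nat -> nat) (y : nat -> seqR R)
    (phi : nat -> seqR R -> R),
  [/\ (forall n, (L n <= k n < L n.+1)%N),
      (forall n, dwp w p (y n) /\ dpow (y n) <= C) &
      (forall n s, uniq s ->
        ws 0 s (cut (fun i => ~~ (L n <= i < L n.+1)%N) (y n)) <= ((2^-1) ^+ n.+1) `^ p)] /\
  [/\ (forall m (a : R) x z, dwp w p x -> dwp w p z ->
        phi m (fun j => a * x j + z j) = a * phi m x + phi m z),
      (forall m n, phi m (T (y n)) = (m == n)%:R) &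
      (forall m, exists2 c : R, `|c| <= Cphi & forall x (eta : R), dwp w p x ->
        (forall j, `|x j| <= eta) -> `|phi m x - c * x (k m)| <= (2^-1) ^+ m.+1 * eta)].
Proof.
have [T1 T2 _] := (LdP T).1 factor_Ld.
have [C [Cphi step]] := proj_step_exists.
have [f [f0 f_ok f_step]] := @dependent_choice_nat ((seqR R -> seqR R) * nat)
  (fun q => proj_ok q.1)
  (fun n q q' => exists h : nat * seqR R * (seqR R -> R),
    proj_step C Cphi n q.1 q'.1 q.2 q'.2 h.1.1 h.1.2 h.2) (fun _ _ => 0, 0%N) proj_ok0
  (fun n q qok => let: ex_intro P' (ex_intro L' (ex_intro k (ex_intro y (ex_intro phi
      (conj ok st))))) := step n q.1 q.2 qok in
    ex_intro _ (P', L') (conj ok (ex_intro _ (k, y, phi) st))).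
have [h st] := choice f_step.
pose y n := (h n).1.2; pose phi n := (h n).2; pose P n := (f n).1.
have yd n : dwp w p (y n) := step_dwp (st n).
have td n : dwp w p (T (y n)) by exact: T1.
have PS n x : dwp w p x -> P n.+1 x = fun j => phi n x * y n j + P n x j.
  exact: (step_next (st n)).
have kill n : P n (T (y n)) = fun=> 0 := step_kill (st n).
have one n : phi n (T (y n)) = 1 := step_one (st n).
have zero n x : dwp w p x -> phi n (T (P n x)) = 0 by exact: (step_zero (st n)).
have Pdwp n x : dwp w p x -> dwp w p (P n x) by exact: (proj_dwp (f_ok n)).
have phiT_PS m n x : dwp w p x -> phi m (T (P n.+1 x)) =
    phi n x * phi m (T (y n)) + phi m (T (P n x)).
  move=> xd; rewrite (PS _ _ xd) (T2 _ _ _ (yd n) (Pdwp n x xd)).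
  exact: step_lin (st m) _ _ _ (td n) (T1 _ (Pdwp n x xd)).
have phi00 m : phi m (fun=> 0) = 0.
  have := step_lin (st m) (-1) dwp0.1 dwp0.1; rewrite -/(phi m).
  by under eq_fun do rewrite mulr0 addr0; move=> ->; ring.
have lower m n : (n < m)%N -> P m (T (y n)) = y n.
  elim: m => // m IH; rewrite ltnS leq_eqVlt (PS _ _ (td n)) => /predU1P[->|nm].
    rewrite kill one.
    by apply/funext => j; rewrite mul1r addr0.
  have Em := IH nm; rewrite Em -[X in phi m (T X)]Em (zero _ _ (td n)).
  by apply/funext => j; rewrite mul0r add0r.
have upper m n : (m < n)%N -> phi m (T (y n)) = 0 /\
    forall x, dwp w p x -> phi m (T (P n x)) = phi m x.
  have gen l : (forall x, dwp w p x -> phi m (T (P l x)) = phi m x) -> phi m (T (y l)) = 0.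
    by move=> H; rewrite -(H _ (td l)) kill (lin_on0 T2) phi00.
  elim: n => // n IH; rewrite ltnS => mn.
  suff H x : dwp w p x -> phi m (T (P n.+1 x)) = phi m x by split; [exact: gen|].
  move=> xd; rewrite (phiT_PS _ _ _ xd).
  move: mn; rewrite leq_eqVlt => /predU1P[<-|/IH[-> ->//]].
    by rewrite one (zero _ _ xd) mulr1 addr0.
  by rewrite mulr0 add0r.
exists C, Cphi, (fun n => (f n).2), (fun n => (h n).1.1), y, phi; split; split.
- by move=> n; exact: (step_k (st n)).
- by move=> n; split; [exact: yd|exact: (step_dpow (st n))].
- by move=> n; exact: (step_out (st n)).
- by move=> m; exact: (step_lin (st m)).
- move=> m n; have [mn|nm|->] := ltngtP m n.
  + exact: (upper _ _ mn).1.
  + by rewrite -[y n](lower _ _ nm) (zero _ _ (td n)).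
  + exact: (step_one (st n)).
- by move=> m; exact: (step_coord (st m)).
Qed.

(** * Factoring the formal identity through T *)

(** Splitting off the first term each time costs one more factor 2^p per index; the coefficients
    grow geometrically but do not depend on N. *)
Lemma quasi_sum (u : nat -> R) N :
  `|\sum_(n < N) u n| `^ p <= \sum_(n < N) (2 `^ p) ^+ n.+1 * `|u n| `^ p.
Proof.
elim: N u => [|N IH] u; first by rewrite !big_ord0 normr0 powR0p.
rewrite !big_ord_recl /= expr1; apply: le_trans (powRD_le p1 _ _) _.
rewrite mulrDr lerD2l.
apply: le_trans (ler_wpM2l (powR_ge0 2 p) (IH (fun n => u n.+1))) _.
rewrite mulr_sumr; apply: ler_sum => i _; rewrite mulrA -exprS.
exact: lexx.
Qed.

Lemma disjoint_sum (u : nat -> nat -> R) (L : nat -> nat) N k :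
  (forall n, (L n <= L n.+1)%N) ->
  (forall n, ~~ (L n <= k < L n.+1)%N -> u n k = 0) ->
  `|\sum_(n < N) u n k| `^ p <= \sum_(n < N) `|u n k| `^ p.
Proof.
move=> LS u0; elim: N => [|N IH]; first by rewrite !big_ord0 normr0 powR0p.
rewrite !big_ord_recr /=; have [NL|kN] := leqP (L N) k; last first.
  by rewrite (u0 N) ?addr0 ?normr0 ?powR0p ?addr0// negb_and -ltnNge kN.
have Lmono n m : (n <= m)%N -> (L n <= L m)%N.
  by move=> /subnK <-; elim: (m - n)%N => // d /leq_trans; apply; rewrite addSn.
rewrite [X in X + u N k]big1 => [|i _].
  by rewrite add0r lerDr sumr_ge0// => i _; exact: powR_ge0.
by rewrite u0// negb_and -leqNgt (leq_trans (Lmono _ _ (ltn_ord i)) NL) orbT.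
Qed.

Lemma geometric_lp : lp p (fun n => (2^-1 : R) ^+ n.+1) /\
  lpow (fun n => (2^-1 : R) ^+ n.+1) <= 1.
Proof.
apply: sum_lp => N; apply: (@le_trans _ _ (1 - (2^-1) ^+ N)); last first.
  by rewrite gerBl exprn_ge0// invr_ge0.
elim: N => [|N IH]; first by rewrite big_ord0 expr0 subrr.
have h0 : 0 <= (2^-1 : R) ^+ N.+1 by rewrite exprn_ge0// invr_ge0.
rewrite big_ord_recr /= (ger0_norm h0).
have h1 : ((2^-1 : R) ^+ N.+1) `^ p <= (2^-1) ^+ N.+1.
  by apply: (powRp_le1 p1); rewrite h0 exprn_ile1// ?invr_ge0// invf_le1// ler1n.
apply: le_trans (lerD IH h1) _; rewrite exprS; lra.
Qed.

Section Factorization.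
Variables (C Cphi : R) (L k : nat -> nat) (y : nat -> seqR R) (phi : nat -> seqR R -> R).
Hypotheses (Lk : forall n, (L n <= k n < L n.+1)%N)
  (yC : forall n, dwp w p (y n) /\ dpow (y n) <= C)
  (y_out : forall n s, uniq s ->
    ws 0 s (cut (fun i => ~~ (L n <= i < L n.+1)%N) (y n)) <= ((2^-1) ^+ n.+1) `^ p).

Let psum (a : seqR R) N : seqR R := fun j => \sum_(n < N) a n * y n j.

Let L_lt n : (L n < L n.+1)%N.
Proof. by have /andP[h1 h2] := Lk n; exact: leq_ltn_trans h1 h2. Qed.

(** In-block parts are disjoint and add up with coefficient 1. Off-block parts carry (2^p)^(n+1)
    from [quasi_sum], cancelled exactly by [y_out]. A single factor 2^p remains, for joining the
    two. *)
Lemma psum_wsum a N s : uniq s ->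
  ws 0 s (psum a N) <= 2 `^ p * (C + 1) * \sum_(n < N) `|a n| `^ p.
Proof.
move=> us; pose I n := fun i => (L n <= i < L n.+1)%N.
pose b n j := a n * cut (I n) (y n) j.
pose r n j := a n * cut (fun i => ~~ I n i) (y n) j.
have E j : psum a N j = \sum_(n < N) b n j + \sum_(n < N) r n j.
  rewrite -big_split; apply: eq_bigr => n _; rewrite /b /r /cut.
  by case: (I n j) => /=; rewrite mulr0 ?addr0 ?add0r.
have h1 : ws 0 s (fun j => \sum_(n < N) b n j) <= \sum_(n < N) `|a n| `^ p * C.
  apply: (@le_trans _ _ (\sum_(n < N) 1 * ws 0 s (b n))).
    apply: (@wsum_comb _ _ _ _ _ _ (fun=> 1) b) => [|j _]; first exact: w_ge0.
    under [leRHS]eq_bigr do rewrite mul1r.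
    apply: (@disjoint_sum b L); first by move=> n; exact: ltnW.
    by move=> n nI; rewrite /b /cut /I (negbTE nI) mulr0.
  apply: ler_sum => n _; rewrite mul1r wsum_scale ler_wpM2l ?powR_ge0//.
  apply: le_trans (yC n).2; apply: le_trans (dwp_wsum (yC n).1 us).
  rewrite -[leRHS]mul1r; apply: wsum_comb1; first exact: w_ge0.
  move=> j _; rewrite mul1r /cut; case: ifP => // _.
  by rewrite normr0 powR0p// powR_ge0.
have h2 : ws 0 s (fun j => \sum_(n < N) r n j) <= \sum_(n < N) `|a n| `^ p * 1.
  apply: (@le_trans _ _ (\sum_(n < N) (2 `^ p) ^+ n.+1 * ws 0 s (r n))).
    apply: (@wsum_comb _ _ _ _ _ _ (fun n => (2 `^ p) ^+ n.+1)) => [|j _]; first exact: w_ge0.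
    exact: (@quasi_sum (fun n => r n j)).
  apply: ler_sum => n _; rewrite wsum_scale mulrCA ler_wpM2l ?powR_ge0//.
  apply: le_trans (ler_wpM2l _ (y_out n us)) _; first by rewrite exprn_ge0// powR_ge0.
  have E2 : (2 `^ p) ^+ n.+1 = (2 ^+ n.+1) `^ p :> R.
    by rewrite -powR_mulrn ?powR_ge0// powRAC powR_mulrn.
  by rewrite E2 -powRM ?exprn_ge0 ?invr_ge0// -exprMn divff ?expr1n ?powR1// pnatr_eq0.
have -> : ws 0 s (psum a N) = ws 0 s (fun j => \sum_(n < N) b n j + \sum_(n < N) r n j).
  by apply: wsum_eq => j _; rewrite E.
apply: le_trans (wsumD p1 0 s _ _ w_ge0) _.
rewrite -mulrA ler_wpM2l ?powR_ge0// mulrDl mul1r mulr_sumr.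
apply: lerD; first by under [leRHS]eq_bigr do rewrite mulrC.
by under [leRHS]eq_bigr do rewrite -[`|_| `^ p]mulr1.
Qed.

Let Cs := 2 `^ p * (C + 1).

Let Cs0 : 0 <= Cs.
Proof.
rewrite mulr_ge0 ?powR_ge0// addr_ge0// (le_trans _ (yC 0).2)//.
exact: dpow_ge0.
Qed.

Lemma psum_dwp a N : dwp w p (psum a N) /\ dpow (psum a N) <= Cs * \sum_(n < N) `|a n| `^ p.
Proof. by apply: wsum_dwp => s us; exact: psum_wsum. Qed.

Lemma psum_lin (S : seqR R -> seqR R) a N : lin_on S ->
  S (psum a N) = fun j => \sum_(n < N) a n * S (y n) j.
Proof.
move=> SL; elim: N => [|N IH].
  rewrite (_ : psum a 0 = fun=> 0); last by apply/funext => j; rewrite /psum big_ord0.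
  by rewrite (lin_on0 SL); apply/funext => j; rewrite big_ord0.
rewrite (_ : psum a N.+1 = fun j => a N * y N j + psum a N j); last first.
  by apply/funext => j; rewrite /psum big_ord_recr addrC.
rewrite (SL _ _ _ (yC N).1 (psum_dwp a N).1) IH.
by apply/funext => j; rewrite big_ord_recr addrC.
Qed.

(* The series [\sum_n a n * y n] is summed along an ultrafilter on [nat]: the partial sums are
   bounded by [psum_dwp], so coordinatewise limits exist without a convergence argument. *)
Lemma synthesis : exists U : seqR R -> seqR R,
  [/\ forall a, lp p a -> dwp w p (U a) /\ dpow (U a) <= Cs * lpow a,
      forall (c : R) a b, lp p a -> lp p b -> lp p (fun j => c * a j + b j) ->
        U (fun j => c * a j + b j) = fun j => c * U a j + U b j &
      forall a (e : R) m, lp p a -> 0 < e -> exists2 N, (m < N)%N &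
        dwp w p (fun j => U a j - psum a N j) /\
        dpow (fun j => U a j - psum a N j) <= e].
Proof.
have [F [FU Foo]] := @ultraFilterLemma nat \oo _.
have FF : ProperFilter F := @ultra_proper _ _ FU.
have psum_le a N : lp p a -> dpow (psum a N) <= Cs * lpow a.
  move=> al; apply: le_trans (psum_dwp a N).2 _.
  by rewrite ler_wpM2l// lp_sum.
have H a : exists l : seqR R, lp p a -> forall j, psum a N j @[N --> F] --> l j.
  have [al|al] := pselect (lp p a); last by exists (fun=> 0).
  have H j : exists l : R, psum a N j @[N --> F] --> l.
    apply: (@ultra_bounded_cvg R F _ (Num.max 1 (Cs * lpow a))) => // N.
    apply: coord_le; rewrite ?le_max ?lexx//; first exact: (psum_dwp a N).1.
    by rewrite psum_le ?orbT.
  by have [l Hl] := choice H; exists l.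
have [U HU] := choice H.
exists U; split.
- move=> a al; apply: (dwp_lim (HU a al)); apply: filterE => N.
  by split; [exact: (psum_dwp a N).1|exact: psum_le].
- move=> c a b al bl cl; apply/funext => j.
  have h1 : psum (fun j => c * a j + b j) N j @[N --> F] --> c * U a j + U b j.
    have -> : (fun N => psum (fun j => c * a j + b j) N j) =
        (fun N => c * psum a N j + psum b N j).
      apply/funext => N; rewrite /psum mulr_sumr -big_split.
      by apply: eq_bigr => n _; rewrite /= mulrDl mulrA.
    by apply: cvgD; [apply: cvgMr; exact: HU|exact: HU].
  exact: cvg_unique (HU _ cl j) h1.
- move=> a e m al e0.
  have e10 : 0 < e / (1 + Cs) by rewrite divr_gt0// ltr_pwDl.
  have [N0 HN0] := lp_tail al e10.
  pose N := (N0 + m.+1)%N; exists N; first by rewrite leq_addl.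
  (* The difference is the coordinatewise limit of sums over indices from N on, whose power is small
     by the l_p tail of a. *)
  apply: (@dwp_lim F _ (fun N' => fun j => psum a N' j - psum a N j)).
    by move=> j; apply: cvgB; [exact: HU|exact: cvg_cst].
  have : F [set N' | (N <= N')%N] by apply: Foo; exists N.
  apply: filterS => N' /= NN'; split; first exact: (dwpB (psum_dwp a N').1 (psum_dwp a N).1).1.
  pose a' := cut (fun n => N <= n)%N a.
  have -> : (fun j => psum a N' j - psum a N j) = psum a' N'.
    apply/funext => j; rewrite /psum -(subnKC NN') big_split_ord [in RHS]big_split_ord /=.
    rewrite addrAC subrr add0r.
    rewrite [X in _ = X + _]big1 => [|i _].
      by rewrite add0r; apply: eq_bigr => i _; rewrite /a' /cut leq_addr.
    by rewrite /a' /cut leqNgt ltn_ord mul0r.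
  apply: le_trans (psum_dwp a' N').2 _.
  rewrite -(subnKC NN') big_split_ord /= big1 => [|i _]; last first.
    by rewrite /a' /cut leqNgt ltn_ord normr0 powR0p.
  rewrite add0r; set d := (N' - N)%N.
  have : \sum_(i < d) `|a' (N + i)%N| `^ p <= e / (1 + Cs).
    apply: le_trans (HN0 (m.+1 + d)%N); rewrite big_split_ord /=.
    rewrite -[leLHS]add0r; apply: lerD.
      by apply: sumr_ge0 => i _; exact: powR_ge0.
    by apply: ler_sum => i _; rewrite /a' /cut leq_addr addnA.
  rewrite ler_pdivlMr ?ltr_pwDl// => h; apply: le_trans h.
  rewrite mulrC ler_wpM2l ?lerDr//; apply: sumr_ge0 => i _; exact: powR_ge0.
Qed.

Hypotheses (phi_lin : forall m (a : R) x z, dwp w p x -> dwp w p z ->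
    phi m (fun j => a * x j + z j) = a * phi m x + phi m z)
  (phi_coord : forall m, exists2 c : R, `|c| <= Cphi & forall x (eta : R), dwp w p x ->
    (forall j, `|x j| <= eta) -> `|phi m x - c * x (k m)| <= (2^-1) ^+ m.+1 * eta).

Let k_inj : injective k.
Proof.
have kS m n : (m < n)%N -> (k m < k n)%N.
  move=> mn; have /andP[_ h1] := Lk m; have /andP[h2 _] := Lk n.
  apply: leq_trans h1 (leq_trans _ h2).
  move: mn => /subnK <-; elim: (n - m.+1)%N => // d /leq_trans; apply.
  by rewrite addSn; exact: ltnW.
by move=> m n E; have [/kS|/kS|//] := ltngtP m n; rewrite E ltnn.
Qed.

(** |phi_m x| is at most Cphi |x_(k m)| plus 2^-(m+1) times the norm of x. As k is injective, m ->
    x_(k m) is x summed along the duplicate-free list [map k s]; the geometric sequence lies in l_p,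
    hence in d_{w,p}. *)
Lemma analysis_bounded : exists2 Cv : R, 0 <= Cv & forall x, dwp w p x ->
  dwp w p (fun m => phi m x) /\ dpow (fun m => phi m x) <= Cv * dpow x.
Proof.
have Cphi0 : 0 <= Cphi by have [c h _] := phi_coord 0; exact: le_trans h.
exists (2 `^ p * (Cphi `^ p + 1)); first by rewrite mulr_ge0 ?powR_ge0// addr_ge0 ?powR_ge0.
move=> x xd; pose eta := dpow x `^ p^-1.
have etap : eta `^ p = dpow x by rewrite -powRrM mulVf ?gt_eqF// powRr1// dpow_ge0.
have xeta j : `|x j| <= eta.
  by apply: (ler_powRp_inv p1); rewrite ?powR_ge0// etap dwp_norm_le.
apply: wsum_dwp => s us.
pose g n := (2^-1 : R) ^+ n.+1.
have H m : `|phi m x| `^ p <= 2 `^ p * Cphi `^ p * `|x (k m)| `^ p +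
    2 `^ p * dpow x * `|g m| `^ p.
  have [c cC Hc] := phi_coord m.
  rewrite -[phi m x](subrK (c * x (k m))) addrC; apply: le_trans (powRD_le p1 _ _) _.
  rewrite mulrDr lerD// -mulrA ler_wpM2l ?powR_ge0//.
    by rewrite normrM powRM// ler_wpM2r ?powR_ge0// ler_powRp.
  have g0 : 0 <= g m by rewrite exprn_ge0// invr_ge0.
  rewrite -etap -powRM ?powR_ge0// ler_powRp// (ger0_norm g0) [eta * _]mulrC.
  exact: Hc.
apply: le_trans (wsum_comb2 0 w_ge0 (fun m _ => H m)) _.
have h1 : ws 0 s (fun m => x (k m)) <= dpow x.
  have -> : ws 0 s (fun m => x (k m)) = ws 0 (map k s) x.
    by elim: s 0%N {us} => //= m s IH o; rewrite IH.
  by apply: dwp_wsum => //; rewrite map_inj_uniq.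
have [gl gl1] := geometric_lp; have [gd gd1] := lp_dwp gl.
have h2 : ws 0 s g <= 1 := le_trans (dwp_wsum gd us) (le_trans gd1 gl1).
have h3 : 0 <= 2 `^ p * dpow x by rewrite mulr_ge0 ?powR_ge0 ?dpow_ge0.
rewrite mulrDr mulrDl mulr1; apply: lerD.
  by rewrite ler_wpM2l// mulr_ge0 ?powR_ge0.
by rewrite ler_piMr.
Qed.

Hypothesis phi_biorth : forall m n, phi m (T (y n)) = (m == n)%:R.

Lemma factorization : exists U V : seqR R -> seqR R,
  [/\ Ld w p V, forall a, lp p a -> dwp w p (U a),
      forall (c : R) a b, lp p a -> lp p b -> lp p (fun j => c * a j + b j) ->
        U (fun j => c * a j + b j) = fun j => c * U a j + U b j,
      exists2 CU : R, 0 <= CU & forall a, lp p a -> dpow (U a) <= CU * lpow a &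
      forall a, lp p a -> V (T (U a)) = a].
Proof.
have [T1 T2 [CT CT0 T3]] := (LdP T).1 factor_Ld.
have [U [U1 U2 U3]] := synthesis; have [Cv Cv0 V3] := analysis_bounded.
exists U, (fun x m => phi m x); split.
- apply/LdP; split.
  + by move=> x /V3[].
  + by move=> a x z xd zd; apply/funext => m; exact: phi_lin.
  + by exists Cv => // x /V3[].
- by move=> a /U1[].
- exact: U2.
- by exists Cs => // a /U1[].
move=> a al; apply/funext => m; apply/eqP; rewrite -subr_eq0 -normr_eq0.
have [/eqP//|n0] := eqVneq `|phi m (T (U a)) - a m| 0.
have q0 : 0 < `|phi m (T (U a)) - a m| `^ p by rewrite powR_gt0// lt_neqAle eq_sym n0 normr_ge0.
(* With c = Cv * CT, a nonzero power q of the difference would satisfy q <= c q / (2 (1 + c)), which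
   is impossible. *)
have D0 : 0 < 2 * (1 + Cv * CT) by rewrite mulr_gt0// ltr_pwDl// mulr_ge0.
have e0 := divr_gt0 q0 D0.
have [N mN [xd xe]] := U3 a _ m al e0.
have Ud := (U1 a al).1; have Sd := (psum_dwp a N).1.
have E : phi m (T (fun j => U a j - psum a N j)) = phi m (T (U a)) - a m.
  have -> : (fun j => U a j - psum a N j) = (fun j => -1 * psum a N j + U a j).
    by apply/funext => j; rewrite mulN1r addrC.
  rewrite (T2 _ _ _ Sd Ud) (phi_lin _ _ (T1 _ Sd) (T1 _ Ud)) mulN1r addrC; congr (_ - _).
  have TL : lin_on (fun x i => phi i (T x)).
    move=> c x z xd' zd; apply/funext => i.
    by rewrite (T2 _ _ _ xd' zd) (phi_lin _ _ (T1 _ xd') (T1 _ zd)).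
  have /(congr1 (fun f => f m)) /= -> := psum_lin a N TL.
  rewrite (bigD1 (Ordinal mN))//= phi_biorth eqxx mulr1 big1 ?addr0// => i im.
  rewrite phi_biorth; case: eqP => [mi|_]; last by rewrite mulr0.
  by move: im; rewrite -val_eqE/= -mi eqxx.
have := dwp_norm_le m (V3 _ (T1 _ xd)).1; rewrite E => h1.
have h2 := (V3 _ (T1 _ xd)).2; have h3 := T3 _ xd.
have h4 : `|phi m (T (U a)) - a m| `^ p <=
    Cv * CT * (`|phi m (T (U a)) - a m| `^ p / (2 * (1 + Cv * CT))).
  apply: le_trans h1 (le_trans h2 _); rewrite -mulrA ler_wpM2l//.
  by apply: le_trans h3 _; rewrite ler_wpM2l.
have CC0 : 0 <= Cv * CT by rewrite mulr_ge0.
exfalso; move: h4 q0; set q := _ `^ p; set c := Cv * CT in CC0 D0 *.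
rewrite mulrA ler_pdivlMr//; nra.
Qed.

End Factorization.
End NonCompact.

End LorentzSums.

(** * Factoring an arbitrary member of J^j through T *)

Theorem theorem4p11 (R : realType) (w : nat -> R) (p : R) :
  1 <= p ->
  w 0%N = 1 ->
  (forall n, w n.+1 <= w n) ->
  w @ \oo --> (0 : R) ->
  (\sum_(0 <= n <oo) (w n)%:E)%E = +oo%E ->
  forall T : seqR R -> seqR R,
    in_Jj w p T -> ~ compact_op w p T ->
    forall S : seqR R -> seqR R, in_Jj w p S -> in_JT w p T S.
Proof.
move=> p1 w0 wS wcv wdiv T [A [B [AL [BL TE]]]] Tnc S [A' [B' [A'L [B'L SE]]]].
have lw : lorentz_weight w p by split.
have [C [Cphi [L [k [y [phi [[h1 h2 h3] [h4 h5 h6]]]]]]]] :=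
  biorthogonal_sequence lw AL BL TE Tnc.
have [U [V [VL U1 U2 [CU CU0 U3] VTU]]] := factorization lw AL BL TE h1 h2 h3 h4 h6 h5.
have [V1 V2 [CV CV0 V3]] := (LdP lw V).1 VL.
have [A1 A2 [CA CA0 A3]] := (LdP lw A').1 A'L.
have [B1 B2 [CB CB0 B3]] := LdlP lw B'L.
exists 1%N, (fun _ x => A' (V x)), (fun _ x => U (B' x)); split; [|split].
- move=> _; apply/(LdP lw); split.
  + by move=> x /V1 /A1.
  + move=> a x z xd zd; rewrite (V2 _ _ _ xd zd).
    exact: A2 (V1 _ xd) (V1 _ zd).
  + exists (CA * CV); first exact: mulr_ge0.
    move=> x xd; apply: le_trans (A3 _ (V1 _ xd)) _.
    by rewrite -mulrA ler_wpM2l// V3.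
- move=> _; apply/(LdP lw); split.
  + by move=> x /B1 /U1.
  (* Linearity of [U] asks that the combination lie in l_p; here it is the image under B' of a
     combination in d_{w,p}. *)
  + move=> a x z xd zd; have cd := (dwpD lw (dwpZ lw a xd).1 zd).1.
    rewrite (B2 _ _ _ xd zd); apply: U2; [exact: B1|exact: B1|].
    by rewrite -(B2 _ _ _ xd zd); exact: B1.
  + exists (CU * CB); first exact: mulr_ge0.
    move=> x xd; apply: le_trans (U3 _ (B1 _ xd)) _.
    by rewrite -mulrA ler_wpM2l// B3.
- move=> x xd j; rewrite big_ord1 (VTU _ (B1 _ xd)) (SE _ xd).
  by [].
Qed.
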